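(* Let $F,f:\mathbb R^n\times\mathbb R^m\to\mathbb R$, $G:\mathbb R^n\times\mathbb R^m\to\mathbb R^q$, $g:\mathbb R^n\times\mathbb R^m\to\mathbb R^p$ be continuously differentiable such that for each fixed $x$, $f(x,\cdot)$ is weakly convex and each component of $g(x,\cdot)$ is quasi-convex. Let $\gamma>0$ and let $(\bar x,\bar y)$ be a local minimizer of $$(\mathrm{VP})_\gamma\qquad\min_{x,y}F(x,y)\quad\text{s.t. } f(x,y)-v_\gamma(x,y)\le0,\ g(x,y)\le0,\ G(x,y)\le0.$$ Suppose one of the following conditions holds: (i) $g$ is quasi-convex in $(x,y)$, $f$ is $\rho_f$-weakly convex on $\operatorname{gph}\mathcal F$ with $\rho_f>0$, $\gamma\in(0,1/\rho_f)$, $\mathcal F(x)\ne\emptyset$ for all $x$ in a neighborhood of $\bar x$, and MSCQ holds for the system $g(x,y)\le0$ at $(\bar x,\bar y)$; (ii) the feasible map $\mathcal F$ satisfies RCR-regularity and RS at $(\bar x,\bar y)$, and $\gamma\in(0,\frac1{2\rho_f})$, where $f(x,\cdot)$ is $\rho_f$-weakly convex for each fixed $x$; (iii) MFCQ holds for the system $g(\bar x,y)\le0$ at $\bar y$, and $\gamma\in(0,\frac1{2\rho_f})$, where $f(x,\cdot)$ is $\rho_f$-weakly convex for each fixed $x$. Suppose that $(\mathrm{VP})_\gamma$ is partially calm at $(\bar x,\bar y)$ in a certain direction $(u,v)\in C(\bar x,\bar y)$, the critical cone of $(\mathrm{VP})_\gamma$. Then there exist $(\alpha,\lambda_g,\lambda_G)\in\mathbb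 R_+\times\mathbb R^{p+q}$ and $\bar\lambda\in\Lambda(\bar x,\bar y)$ satisfying $$0=\nabla F(\bar x,\bar y)+\nabla g(\bar x,\bar y)^T(\lambda_g-\alpha\bar\lambda)+\nabla G(\bar x,\bar y)^T\lambda_G,\qquad0\le\lambda_g\perp g(\bar x,\bar y),\quad0\le\lambda_G\perp G(\bar x,\bar y).$$
   Context: Definitions. $\mathcal F(x):=\{y\in\mathbb R^m\mid g(x,y)\le0\}$; the Moreau envelope function is $v_\gamma(x,y):=\inf_w\{f(x,w)+\frac1{2\gamma}\|w-y\|^2\mid g(x,w)\le0\}$. A function $h$ is $\rho$-weakly convex ($\rho\ge0$) on a convex set $D$ if $h+\frac\rho2\|\cdot\|^2$ is convex on $D$ (on the whole space if $D$ is not mentioned), and weakly convex if this holds for some $\rho\ge0$; if $\rho_f=0$, $1/(2\rho_f)$ is read as $+\infty$. Quasi-convex: all sublevel sets (of each component) are convex. $I_g(x,y):=\{i\mid g_i(x,y)=0\}$, similarly $I_G$; $\nabla g(x,y)(u,v)$ is the Jacobian applied to $(u,v)$; $a\perp b$ means $\langle a,b\rangle=0$; $\mathbb B$ is the open unit ball, $\mathbb B_\epsilon(\bar z)$ the open ball of radius $\epsilon$; $a_+$ is the componentwise positive part. $\Lambda(x,y):=\{\lambda\in\mathbb R^p_+\mid\nabla_yf(x,y)+\nabla_yg(x,y)^T\lambda=0,\ g(x,y)^T\lambda=0\}$. Critical cone: $C(\bar x,\bar y):=\{(u,v)\mid\nabla f(\bar x,\bar y)(u,v)\le(v_\gamma)'_+(\bar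 x,\bar y;u,v),\ \nabla F(\bar x,\bar y)(u,v)\le0,\ \nabla g_i(\bar x,\bar y)(u,v)\le0\ \forall i\in I_g(\bar x,\bar y),\ \nabla G_i(\bar x,\bar y)(u,v)\le0\ \forall i\in I_G(\bar x,\bar y)\}$, where $\psi'_+(z;d):=\limsup_{t\downarrow0}\frac{\psi(z+td)-\psi(z)}t$. MSCQ for $g(x,y)\le0$ at $(\bar x,\bar y)$: there are $\epsilon,\kappa>0$ with $\operatorname{dist}((x,y),\{g\le0\})\le\kappa\|g_+(x,y)\|$ for all $(x,y)\in\mathbb B_\epsilon(\bar x,\bar y)$. RCR-regularity of $\mathcal F$ at $(\bar x,\bar y)$: there is $\delta>0$ such that for every $K\subseteq I_g(\bar x,\bar y)$ the family $\nabla_yg_j(x,y)$, $j\in K$, has the same rank at all $(x,y)\in\mathbb B_\delta(\bar x,\bar y)$. Robinson stability (RS) of $\mathcal F$ at $(\bar x,\bar y)$: there are $\kappa,\epsilon>0$ with $\operatorname{dist}(y,\mathcal F(x))\le\kappa\|g_+(x,y)\|$ for all $x\in\mathbb B_\epsilon(\bar x)$, $y\in\mathbb B_\epsilon(\bar y)$. MFCQ for $g(\bar x,y)\le0$ at $\bar y$: $\nabla_yg(\bar x,\bar y)^T\lambda=0$, $0\le\lambda\perp g(\bar x,\bar y)$ imply $\lambda=0$. Directional neighborhood: $\mathcal V_{\epsilon,\delta}(d):=\{z\in\epsilon\mathbb B\mid\big\|\|d\|z-\|z\|d\big\|\le\delta\|z\|\|d\|\}$. Partial calmness of $(\mathrm{VP})_\gamma$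 at $(\bar x,\bar y)$ in direction $(u,v)$: there are $\epsilon,\delta,\rho>0$ such that for every $(\alpha,\beta)\in\epsilon\mathbb B\subset\mathbb R^{1+q}$ and every $(x,y)\in\operatorname{gph}\mathcal F\cap((\bar x,\bar y)+\mathcal V_{\epsilon,\delta}(u,v))$ with $f(x,y)-v_\gamma(x,y)+\alpha\le0$ and $G(x,y)+\beta\le0$ one has $F(x,y)-F(\bar x,\bar y)+\rho\|(\alpha,\beta)\|\ge0$. *)

(* Defs.v *)
From HB Require Import structures.
From mathcomp Require Import all_boot all_order all_algebra.
From mathcomp Require Import all_classical all_reals all_analysis.

Set Implicit Arguments.
Unset Strict Implicit.
Unset Printing Implicit Defensive.

Import Order.TTheory GRing.Theory Num.Theory.
Import numFieldNormedType.Exports.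

Local Open Scope classical_set_scope.
Local Open Scope ring_scope.

(** Points of R^n x R^m are pairs [z = (x, y)] of column vectors.  The topology
    on matrices and pairs is the library's (that of the max norm); every
    quantitative notion below uses the Euclidean norm [enorm]. *)

Section Euclidean.
Variable R : realType.

Definition dot k (a b : 'cV[R]_k) : R := \sum_i a i 0 * b i 0.

Definition enorm k (a : 'cV[R]_k) : R := Num.sqrt (dot a a).

Definition pnorm n m (z : 'cV[R]_n * 'cV[R]_m) : R := enorm (col_mx z.1 z.2).

Definition nonneg k (a : 'cV[R]_k) : Prop := forall i, 0 <= a i 0.

Definition nonpos k (a : 'cV[R]_k) : Prop := forall i, a i 0 <= 0.

Definition pos_part k (a : 'cV[R]_k) : 'cV[R]_k := \col_i Num.max (a i 0) 0.

(** The distance to the empty set is [+oo]. *)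
Definition dist k (y : 'cV[R]_k) (S : set 'cV[R]_k) : \bar R :=
  ereal_inf [set (enorm (y - w))%:E | w in S].

Definition pdist n m (z : 'cV[R]_n * 'cV[R]_m) (S : set ('cV[R]_n * 'cV[R]_m)) :
  \bar R := ereal_inf [set (pnorm (z - w))%:E | w in S].

End Euclidean.

Section Convexity.
Variable R : realType.

Definition wconvex k (rho : R) (D : set 'cV[R]_k) (h : 'cV[R]_k -> R) : Prop :=
  0 <= rho /\
  convex_function (D : set (convex_lmodType 'cV[R]_k))
    (fun y => h y + rho / 2 * enorm y ^+ 2).

Definition pwconvex n m (rho : R) (D : set ('cV[R]_n * 'cV[R]_m))
    (h : 'cV[R]_n * 'cV[R]_m -> R) : Prop :=
  0 <= rho /\
  convex_function (D : set (convex_lmodType ('cV[R]_n * 'cV[R]_m)%type))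
    (fun z => h z + rho / 2 * pnorm z ^+ 2).

Definition quasiconvex (E : lmodType R) (h : E -> R) : Prop :=
  forall a : R, @convex_set R E [set z | h z <= a].

End Convexity.

Section Differentiation.
Variables (R : realType) (n m : nat).
Implicit Types (z : 'cV[R]_n * 'cV[R]_m) (h : 'cV[R]_n * 'cV[R]_m -> R).

Definition gradx h z : 'cV[R]_n := \col_i 'D_((delta_mx i 0, 0)) h z.

Definition grady h z : 'cV[R]_m := \col_j 'D_((0, delta_mx j 0)) h z.

Definition grad h z : 'cV[R]_(n + m) := col_mx (gradx h z) (grady h z).

Definition cont_diff h : Prop :=
  (forall z, differentiable h z) /\ continuous (grad h).

Section VectorValued.
Variables (k : nat) (g : 'cV[R]_n * 'cV[R]_m -> 'cV[R]_k).

Definition component (i : 'I_k) : 'cV[R]_n * 'cV[R]_m -> R := fun z => g z i 0.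

Definition cont_diffv : Prop := forall i, cont_diff (component i).

Definition jac z : 'M[R]_(k, n + m) := \matrix_(i, j) grad (component i) z j 0.

Definition jacy z : 'M[R]_(k, m) := \matrix_(i, j) grady (component i) z j 0.

Definition active z : {set 'I_k} := [set i | g z i 0 == 0]%SET.

End VectorValued.
End Differentiation.

Section Bilevel.
Variables (R : realType) (n m : nat).
Local Notation X := ('cV[R]_n).
Local Notation Y := ('cV[R]_m).
Local Notation Z := ('cV[R]_n * 'cV[R]_m)%type.

Section Constraints.
Variables (p : nat) (g : Z -> 'cV[R]_p).

Definition feas (x : X) : set Y := [set y | nonpos (g (x, y))].

Definition gph_feas : set Z := [set z | feas z.1 z.2].

Definition MSCQ (zbar : Z) : Prop :=
  exists eps kappa : R, [/\ 0 < eps, 0 < kappa &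
    forall z, pnorm (z - zbar) < eps ->
      (pdist z [set w | nonpos (g w)] <= (kappa * enorm (pos_part (g z)))%:E)%E].

(** [rowsub] by [enum_val] keeps the rows of the Jacobian indexed by [K]. *)
Definition RCR (zbar : Z) : Prop :=
  exists2 delta : R, 0 < delta &
    forall K : {set 'I_p}, K \subset active g zbar ->
    forall z w : Z, pnorm (z - zbar) < delta -> pnorm (w - zbar) < delta ->
      \rank (rowsub (fun i : 'I_#|K| => enum_val i) (jacy g z)) =
      \rank (rowsub (fun i : 'I_#|K| => enum_val i) (jacy g w)).

Definition RS (zbar : Z) : Prop :=
  exists kappa eps : R, [/\ 0 < kappa, 0 < eps &
    forall x y, enorm (x - zbar.1) < eps -> enorm (y - zbar.2) < eps ->
      (dist y (feas x) <= (kappa * enorm (pos_part (g (x, y))))%:E)%E].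

Definition MFCQ (zbar : Z) : Prop :=
  forall lam : 'cV[R]_p, (jacy g zbar)^T *m lam = 0 ->
    nonneg lam -> dot lam (g zbar) = 0 -> lam = 0.

End Constraints.

Section Problem.
Variables (p q : nat).
Variables (F f : Z -> R) (G : Z -> 'cV[R]_q) (g : Z -> 'cV[R]_p) (gamma : R).

(** Extended-real valued: [+oo] when [feas g x] is empty. *)
Definition moreau (z : Z) : \bar R :=
  ereal_inf [set (f (z.1, w) + (2 * gamma)^-1 * enorm (w - z.2) ^+ 2)%:E
            | w in feas g z.1].

Definition VPfeas : set Z :=
  [set z | [/\ ((f z)%:E - moreau z <= 0)%E, nonpos (g z) & nonpos (G z)]].

Definition VPlocal_min (zbar : Z) : Prop :=
  VPfeas zbar /\ \forall z \near zbar, VPfeas z -> F zbar <= F z.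

Definition multipliers (z : Z) : set 'cV[R]_p :=
  [set lam | [/\ nonneg lam, grady f z + (jacy g z)^T *m lam = 0
               & dot (g z) lam = 0]].

Definition upper_dini (psi : Z -> \bar R) (z d : Z) : \bar R :=
  limf_esup (fun t : R => ((t^-1)%:E * (psi (z + t *: d)%R - psi z))%E)
    (0 : R)^'+.

Definition critical_cone (zbar : Z) : set Z :=
  [set d | let d' := col_mx d.1 d.2 in
    [/\ ((dot (grad f zbar) d')%:E <= upper_dini moreau zbar d)%E,
        dot (grad F zbar) d' <= 0,
        forall i, i \in active g zbar -> (jac g zbar *m d') i 0 <= 0 &
        forall i, i \in active G zbar -> (jac G zbar *m d') i 0 <= 0]].

Definition dir_nbhd (eps delta : R) (d : Z) : set Z :=
  [set z | pnorm z < eps /\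
     pnorm (pnorm d *: z - pnorm z *: d) <= delta * pnorm z * pnorm d].

(** [col_mx alpha%:M beta] is the vector (alpha, beta) of R^(1+q). *)
Definition partially_calm (zbar d : Z) : Prop :=
  exists eps delta rho : R, [/\ 0 < eps, 0 < delta, 0 < rho &
    forall (alpha : R) (beta : 'cV[R]_q) (z : Z),
      enorm (col_mx (alpha%:M : 'cV[R]_1) beta) < eps ->
      gph_feas g z -> dir_nbhd eps delta d (z - zbar) ->
      ((f z)%:E - moreau z + alpha%:E <= 0)%E -> nonpos (G z + beta) ->
      0 <= F z - F zbar + rho * enorm (col_mx (alpha%:M : 'cV[R]_1) beta)].

End Problem.
End Bilevel.

(* Main.v *)
Require Import Defs.
From HB Require Import structures.
From mathcomp Require Import all_boot all_order all_algebra.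
From mathcomp Require Import all_classical all_reals all_analysis.
From mathcomp Require Import ring lra.

Set Implicit Arguments.
Unset Strict Implicit.
Unset Printing Implicit Defensive.

Import Order.TTheory GRing.Theory Num.Theory.
Import numFieldNormedType.Exports.

Local Open Scope classical_set_scope.
Local Open Scope ring_scope.

(** The constraint [f - v <= 0], where [v] is the Moreau envelope, is an equality
    on the graph of the feasible map, and partial calmness makes it penalizable:
    along the given direction [d0] the reference point [zb] minimizes
    [F + rho * (f - v) + rho * |G_+|] over [g <= 0].  The multipliers are those of
    this penalized problem, with [alpha = rho].

    The argument rests on a one-sided first-order bound for [v] that is uniform
    near [zb] ([envelope_step]): if [(a, b)] is a linearized feasible
    direction for [g], then
      [v (z.1 + t a, y1) <= v z + t (slope f zb (a, b) + o(1))].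
    It has a direct proof: move a near-optimal candidate for [z] along [(a, b)] and
    correct it to a feasible one.  This uses two facts.
    - Small violations of the constraints can be corrected at proportional cost
      with the parameter fixed ([correctable]).  Robinson stability says so; MFCQ
      gives it through a direction that decreases all active constraints; under
      MSCQ and joint quasi-convexity one corrects the pair first and then restores
      the parameter by a convex combination.
    - Near-optimal candidates stay close to [zb.2] ([prox_localization]), because
      the lower-level objective plus the proximal term is strongly convex on the
      fibres of the feasible map.

    The optimality system of the penalized problem is linear in the multipliers
    once [rho * lambda] is taken as an unknown.  If it has no solution, Farkas'
    lemma provides [d] and [e] such that [d] is a linearized feasible direction,
    [(- d.1, e - d.2)] is one for [g], and
    [slope F zb d + rho * slope f zb (0, e) < 0] ([kkt_alternative]).
    Go from [zb] to a feasible point [z'] close to [zb + t (d0 + s d)].  For suitable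
    small [t], criticality of [d0] bounds [v] from below at [zb + t d0], and the
    envelope bound from [z'] along [(- d.1, e - d.2)] turns this into a lower bound
    at [z'].  The objective of the penalized problem is then smaller at [z'] than at
    [zb] by a multiple of [t], which contradicts calmness ([calm_no_descent]).  The
    envelope bound is used backwards, from [z'] and not from [zb]; this is why it
    has to be uniform, as in Clarke's derivative. *)

(** * Euclidean norms *)

Section EuclideanTheory.
Variable R : realType.

Lemma dotC k (a b : 'cV[R]_k) : dot a b = dot b a.
Proof. by apply: eq_bigr => i _; rewrite mulrC. Qed.

Lemma dotDl k (a b c : 'cV[R]_k) : dot (a + b) c = dot a c + dot b c.
Proof. by rewrite /dot -big_split; apply: eq_bigr => i _; rewrite mxE mulrDl. Qed.

Lemma dotZl k t (a b : 'cV[R]_k) : dot (t *: a) b = t * dot a b.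
Proof. by rewrite /dot mulr_sumr; apply: eq_bigr => i _; rewrite mxE mulrA. Qed.

Lemma dotNl k (a b : 'cV[R]_k) : dot (- a) b = - dot a b.
Proof. by rewrite -scaleN1r dotZl mulN1r. Qed.

Lemma dotBl k (a b c : 'cV[R]_k) : dot (a - b) c = dot a c - dot b c.
Proof. by rewrite dotDl dotNl. Qed.

Lemma dotDr k (a b c : 'cV[R]_k) : dot a (b + c) = dot a b + dot a c.
Proof. by rewrite dotC dotDl !(dotC a). Qed.

Lemma dotZr k t (a b : 'cV[R]_k) : dot a (t *: b) = t * dot a b.
Proof. by rewrite dotC dotZl dotC. Qed.

Lemma dotNr k (a b : 'cV[R]_k) : dot a (- b) = - dot a b.
Proof. by rewrite dotC dotNl dotC. Qed.

Lemma dotBr k (a b c : 'cV[R]_k) : dot a (b - c) = dot a b - dot a c.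
Proof. by rewrite dotDr dotNr. Qed.

Lemma dot0r k (a : 'cV[R]_k) : dot a 0 = 0.
Proof. by rewrite -(scale0r 0) dotZr mul0r. Qed.

Lemma dot_col_mx j k (a c : 'cV[R]_j) (b d : 'cV[R]_k) :
  dot (col_mx a b) (col_mx c d) = dot a c + dot b d.
Proof.
by rewrite /dot big_split_ord; congr (_ + _); apply: eq_bigr => i _;
  rewrite ?col_mxEu ?col_mxEd.
Qed.

Lemma dot_ge0 k (a : 'cV[R]_k) : 0 <= dot a a.
Proof. by apply: sumr_ge0 => i _; rewrite -expr2 sqr_ge0. Qed.

Lemma enorm_ge0 k (a : 'cV[R]_k) : 0 <= enorm a.
Proof. exact: sqrtr_ge0. Qed.

Lemma enorm_sqr k (a : 'cV[R]_k) : enorm a ^+ 2 = dot a a.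
Proof. by rewrite sqr_sqrtr // dot_ge0. Qed.

Lemma normr_coord k (a : 'cV[R]_k) i : `|a i 0| <= `|a|.
Proof.
by rewrite [leRHS]/Num.norm /= mx_normrE; apply/bigmax_geP; right; exists (i, 0).
Qed.

Lemma normr_cV_le k (a : 'cV[R]_k) c :
  0 <= c -> (forall i, `|a i 0| <= c) -> `|a| <= c.
Proof.
move=> c0 ac; rewrite /Num.norm /= mx_normrE; apply/bigmax_leP; split => // -[i j] _.
by rewrite /= ord1.
Qed.

Lemma coord_le_enorm k (a : 'cV[R]_k) i : `|a i 0| <= enorm a.
Proof.
rewrite -sqrtr_sqr; apply: ler_wsqrtr; rewrite /dot (bigD1 i) //= -expr2 lerDl.
by apply: sumr_ge0 => j _; rewrite -expr2 sqr_ge0.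
Qed.

Lemma norm_le_enorm k (a : 'cV[R]_k) : `|a| <= enorm a.
Proof. by apply: normr_cV_le => [|i]; rewrite ?enorm_ge0 ?coord_le_enorm. Qed.

Lemma dot_le_norm k (a b : 'cV[R]_k) : `|dot a b| <= k%:R * `|a| * `|b|.
Proof.
apply: le_trans (ler_norm_sum _ _ _) _.
apply: (@le_trans _ _ (\sum_(i < k) `|a| * `|b|)).
  by apply: ler_sum => i _; rewrite normrM ler_pM ?normr_coord.
by rewrite sumr_const card_ord -[in leLHS]mulr_natl mulrA.
Qed.

Lemma enorm_le_norm k (a : 'cV[R]_k) : enorm a <= k%:R * `|a|.
Proof.
rewrite -(ler_pXn2r (n := 2)) ?nnegrE ?enorm_ge0 ?mulr_ge0 // enorm_sqr.
apply: le_trans (ler_norm _) _; apply: le_trans (dot_le_norm _ _) _.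
rewrite exprMn -mulrA -expr2 ler_wpM2r ?exprn_ge0 // -natrX ler_nat.
by case: k {a} => // k; rewrite leq_pmulr.
Qed.

Lemma enorm_eq0 k (a : 'cV[R]_k) : enorm a = 0 -> a = 0.
Proof.
move=> a0; apply/eqP; rewrite -normr_eq0 eq_le normr_ge0 andbT.
by rewrite -a0 norm_le_enorm.
Qed.

Lemma enormZ k t (a : 'cV[R]_k) : enorm (t *: a) = `|t| * enorm a.
Proof. by rewrite /enorm dotZl dotZr mulrA -expr2 sqrtrM ?sqr_ge0 // sqrtr_sqr. Qed.

Lemma CauchySchwarz_dot k (a b : 'cV[R]_k) : dot a b <= enorm a * enorm b.
Proof.
have [b0|bN0] := eqVneq (enorm b) 0.
  by rewrite b0 mulr0 (enorm_eq0 b0) dot0r.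
have b_gt0 : 0 < enorm b by rewrite lt_neqAle eq_sym bN0 enorm_ge0.
apply: le_trans (ler_norm _) _.
rewrite -(ler_pXn2r (n := 2)) ?nnegrE ?mulr_ge0 ?enorm_ge0 //.
rewrite real_normK ?num_real // exprMn !enorm_sqr.
have bb : 0 < dot b b by rewrite -enorm_sqr exprn_gt0.
have := dot_ge0 (dot b b *: a - dot a b *: b).
rewrite dotBl !dotBr !dotZl !dotZr (dotC b a) => h.
rewrite -(ler_pM2l bb) -subr_ge0; apply: le_trans h _.
rewrite le_eqVlt; apply/orP; left; apply/eqP; ring.
Qed.

Lemma enorm_triangle k (a b : 'cV[R]_k) : enorm (a + b) <= enorm a + enorm b.
Proof.
rewrite -(ler_pXn2r (n := 2)) ?nnegrE ?addr_ge0 ?enorm_ge0 //.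
rewrite enorm_sqr dotDl !dotDr (dotC b a) sqrrD !enorm_sqr.
have := CauchySchwarz_dot a b; lra.
Qed.

End EuclideanTheory.

(** * Linear alternatives *)

Section Alternatives.
Variable R : realType.

(** Bartl's induction on the number of generators, seen as linear forms.  If some
    [x0] separates [c] from the first [k] of them, the last one is positive at
    [x0], say equal to 1; composing all forms with the projection along [x0] onto
    the kernel of the last one removes that form. *)
Lemma farkas_sum N k (a : 'I_k -> 'cV[R]_N) (c : 'cV[R]_N) :
  (forall x, (forall i, dot (a i) x <= 0) -> dot c x <= 0) ->
  exists2 lam : 'I_k -> R, (forall i, 0 <= lam i) & c = \sum_i lam i *: a i.
Proof.
elim: k a c => [|k IH] a c sep.
  exists (fun=> 0) => //; rewrite big_ord0; apply: enorm_eq0; apply/eqP.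
  rewrite -sqrf_eq0 enorm_sqr eq_le dot_ge0 andbT.
  by apply: sep => -[].
pose a' i := a (lift ord_max i); pose l := a ord_max.
have sumE (b : 'I_k.+1 -> 'cV[R]_N) :
    \sum_i b i = \sum_(i < k) b (lift ord_max i) + b ord_max.
  rewrite big_ord_recr; congr (_ + _); apply: eq_bigr => i _; congr b.
  by apply/val_inj; rewrite /= /bump leqNgt ltn_ord.
have [sep'|nsep] := pselect
    (forall x, (forall i, dot (a' i) x <= 0) -> dot c x <= 0).
  have [lam lam0 cE] := IH _ _ sep'.
  exists (fun i => if unlift ord_max i is Some j then lam j else 0).
    by move=> i; case: unliftP.
  rewrite sumE unlift_none scale0r addr0 cE.
  by apply: eq_bigr => i _; rewrite liftK.
have [x1 [ax1 cx1]] : exists x, (forall i, dot (a' i) x <= 0) /\ 0 < dot c x.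
  apply: contrapT => nx; apply: nsep => x ax; rewrite leNgt; apply/negP => cx.
  by apply: nx; exists x.
have lx1 : 0 < dot l x1.
  rewrite ltNge; apply/negP => lx1; move: cx1; apply/negP; rewrite -leNgt.
  by apply: sep => i; case: (unliftP ord_max i) => [j|] ->; [exact: ax1|].
have [x0 [lx0 ax0 cx0]] : exists x0,
    [/\ dot l x0 = 1, forall i, dot (a' i) x0 <= 0 & 0 < dot c x0].
  exists ((dot l x1)^-1 *: x1); split=> [|i|]; rewrite dotZr.
  - by rewrite mulVf ?gt_eqF.
  - by rewrite mulr_ge0_le0 // invr_ge0 ltW.
  - by rewrite mulr_gt0 // invr_gt0.
pose pr (b : 'cV[R]_N) := b - dot b x0 *: l.
have prE b x : dot (pr b) x = dot b (x - dot l x *: x0).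
  by rewrite /pr dotBl dotZl dotBr dotZr mulrC.
have [x ax|lam lam0 cE] := IH (fun i => pr (a' i)) (pr c).
  rewrite prE; apply: sep => i; case: (unliftP ord_max i) => [j|] ->.
    by rewrite -prE ax.
  by rewrite dotBr dotZr lx0 mulr1 subrr.
pose mu := dot c x0 - \sum_i lam i * dot (a' i) x0.
have mu0 : 0 <= mu.
  rewrite subr_ge0; apply: le_trans (ltW cx0).
  by apply: sumr_le0 => i _; rewrite mulr_ge0_le0.
exists (fun i => if unlift ord_max i is Some j then lam j else mu).
  by move=> i; case: unliftP.
rewrite sumE unlift_none.
rewrite (eq_bigr (fun i => lam i *: a' i)); last by move=> i _; rewrite liftK.
have -> : c = pr c + dot c x0 *: l by rewrite subrK.
rewrite cE (eq_bigr (fun i => lam i *: a' i - (lam i * dot (a' i) x0) *: l)).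
  rewrite sumrB -scaler_suml -addrA; congr (_ + _).
  by rewrite -scaleNr -scalerDl addrC.
by move=> i _; rewrite scalerBr scalerA.
Qed.

Lemma dot_mulmx_tr N k (A : 'M[R]_(N, k)) (x : 'cV[R]_N) i :
  (A^T *m x) i 0 = dot (col i A) x.
Proof. by rewrite mxE; apply: eq_bigr => j _; rewrite !mxE. Qed.

Lemma farkas N k (A : 'M[R]_(N, k)) (c : 'cV[R]_N) :
  (exists2 lam, nonneg lam & A *m lam = c) \/
  (exists2 x, nonpos (A^T *m x) & 0 < dot c x).
Proof.
have [sep|] := pselect (forall x, nonpos (A^T *m x) -> dot c x <= 0).
  left; have [x ax|lam lam0 cE] := @farkas_sum N k (fun i => col i A) c.
    by apply: sep => i; rewrite dot_mulmx_tr.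
  exists (\col_i lam i) => [i|]; first by rewrite mxE.
  rewrite cE; apply/colP => j; rewrite summxE mxE; apply: eq_bigr => i _.
  by rewrite !mxE mulrC.
move=> nsep; right; apply: contrapT => nx; apply: nsep => x ax.
by rewrite leNgt; apply/negP => cx; apply: nx; exists x.
Qed.

End Alternatives.

(** * First-order expansions *)

Section Expansions.
Variables (R : realType) (n m : nat).
Local Notation Z := ('cV[R]_n * 'cV[R]_m)%type.
Implicit Types (z d : Z) (h : Z -> R).

Definition slope h z d : R := dot (grad h z) (col_mx d.1 d.2).

Lemma slopeD h z d e : slope h z (d + e) = slope h z d + slope h z e.
Proof. by rewrite /slope -dotDr add_col_mx. Qed.

Lemma slopeZ h z t d : slope h z (t *: d) = t * slope h z d.
Proof. by rewrite /slope -dotZr scale_col_mx. Qed.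

Lemma slopeN h z d : slope h z (- d) = - slope h z d.
Proof. by rewrite -scaleN1r slopeZ mulN1r. Qed.

Lemma normr_fst z : `|z.1| <= `|z|.
Proof. by rewrite prod_normE le_max lexx. Qed.

Lemma normr_snd z : `|z.2| <= `|z|.
Proof. by rewrite prod_normE le_max lexx orbT. Qed.

Lemma normr_pair_le (x : 'cV[R]_n) (y : 'cV[R]_m) c :
  `|x| <= c -> `|y| <= c -> `|(x, y)| <= c.
Proof. by move=> xc yc; rewrite prod_normE ge_max xc yc. Qed.

Lemma normr_pair_lt (x : 'cV[R]_n) (y : 'cV[R]_m) c :
  `|x| < c -> `|y| < c -> `|(x, y)| < c.
Proof. by move=> xc yc; rewrite prod_normE gt_max xc yc. Qed.

Lemma norm_col_mx z : `|col_mx z.1 z.2| <= `|z|.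
Proof.
apply: normr_cV_le => // i; case: (splitP i) => j ij.
  rewrite (_ : i = lshift m j) ?col_mxEu; last exact/val_inj.
  exact: le_trans (normr_coord _ _) (normr_fst z).
rewrite (_ : i = rshift n j) ?col_mxEd; last exact/val_inj.
exact: le_trans (normr_coord _ _) (normr_snd z).
Qed.

Lemma derive_slope h z d : differentiable h z -> 'D_d h z = slope h z d.
Proof.
move=> hz; rewrite deriveE //.
have {1}-> : d = \sum_i d.1 i 0 *: (delta_mx i 0 : 'cV[R]_n, 0 : 'cV[R]_m)
               + \sum_j d.2 j 0 *: (0 : 'cV[R]_n, delta_mx j 0 : 'cV[R]_m).
  have pairD (a c : 'cV[R]_n) (b e : 'cV[R]_m) : (a, b) + (c, e) = (a + c, b + e).
    by [].
  rewrite (eq_bigr (fun i => (d.1 i 0 *: delta_mx i 0 : 'cV[R]_n, 0 : 'cV[R]_m)));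
    last by move=> i _; congr pair; rewrite scaler0.
  rewrite [X in _ + X](eq_bigr (fun j =>
    (0 : 'cV[R]_n, d.2 j 0 *: delta_mx j 0 : 'cV[R]_m)));
    last by move=> i _; congr pair; rewrite scaler0.
  have fsum (I : finType) (a : I -> 'cV[R]_n) (b : I -> 'cV[R]_m) :
      \sum_i (a i, b i) = (\sum_i a i, \sum_i b i).
    by elim/big_rec3 : _ => // i x y w _ ->.
  rewrite !fsum !big1_eq pairD addr0 add0r [LHS]surjective_pairing.
  by congr pair; rewrite [LHS]matrix_sum_delta; apply: eq_bigr => i _;
    rewrite big_ord1.
rewrite linearD !linear_sum /slope dot_col_mx; congr (_ + _);
  by apply: eq_bigr => i _; rewrite linearZ /= mulrC mxE deriveE.
Qed.

Lemma is_derive_line h z d (s : R) : differentiable h (z + s *: d) ->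
  is_derive s 1 (fun s => h (z + s *: d)) (slope h (z + s *: d) d).
Proof.
move=> hz.
have L : is_diff s (fun s : R => z + s *: d) (fun r => r *: d).
  by apply: is_diff_eq; apply/funext => r /=; congr pair; rewrite add0r.
have := @is_diff_comp _ _ _ _ _ _ _ _ _ L (differentiableP hz).
move=> [dc ec]; apply: DeriveDef; first exact: diff_derivable.
by rewrite deriveE // ec /= scale1r -deriveE // derive_slope.
Qed.

(** Strict differentiability of C1 functions.  The mean value theorem writes the
    increment as a derivative at an intermediate point, where the gradient is
    close to the one at [z0]. *)
Lemma strict_diff h z0 eta : cont_diff h -> 0 < eta ->
  \forall r \near (0 : R)^'+, forall z d, `|z - z0| < r -> `|z + d - z0| < r ->
    `|h (z + d) - h z - slope h z0 d| <= eta * `|d|.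
Proof.
move=> [hd hc] eta0; pose N := (n + m)%:R : R.
have e1 : 0 < eta / (N + 1) by rewrite divr_gt0 // ltr_wpDl.
have /cvgrPdist_le /(_ _ e1) := hc z0.
move=> /nbhs_normP[e /= e0 He].
near=> r => z d zr zdr.
have line s : 0 <= s <= 1 -> `|z + s *: d - z0| < r.
  move=> /andP[s0 s1].
  have -> : z + s *: d - z0 = (1 - s) *: (z - z0) + s *: (z + d - z0).
    by rewrite scalerBl scale1r [z + d - z0]addrAC [_ *: (_ + d)]scalerDr addrA subrK addrAC.
  apply: le_lt_trans (ler_normD _ _) _; rewrite !normrZ !ger0_norm ?subr_ge0 //.
  have [->|sN1] := eqVneq s 1; first by rewrite subrr mul0r add0r mul1r.
  have s1' : 0 < 1 - s by rewrite subr_gt0 lt_neqAle sN1.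
  have : (1 - s) * `|z - z0| < (1 - s) * r by rewrite ltr_pM2l.
  have : s * `|z + d - z0| <= s * r by rewrite ler_wpM2l // ltW.
  lra.
have [s _||c c01] := @MVT_segment R (fun s => h (z + s *: d))
    (fun s => slope h (z + s *: d) d) 0 1 ler01.
- by apply: is_derive_line; apply: hd.
- apply: continuous_subspaceT => s.
  apply/differentiable_continuous/derivable1_diffP.
  by have [] := @is_derive_line h z d s (hd _).
rewrite scale1r scale0r addr0 subr0 mulr1 => ->.
rewrite /slope -dotBl; apply: le_trans (dot_le_norm _ _) _.
apply: (@le_trans _ _ (N * (eta / (N + 1)) * `|d|)).
  apply: ler_pM; rewrite ?mulr_ge0 ?norm_col_mx // ler_wpM2l // distrC.
  apply: He; rewrite /= distrC; apply: lt_le_trans (line c _) _.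
    by move: c01; rewrite in_itv.
  by near: r; apply: nbhs_right_le.
rewrite ler_wpM2r // mulrCA ger_pMr // ler_pdivrMr ?mul1r ?lerDl //.
by rewrite ltr_wpDl.
Unshelve. all: by end_near. Qed.

Lemma lipschitz_C1 h z0 : cont_diff h ->
  exists2 L : R, 0 < L & \forall r \near (0 : R)^'+, forall z d,
    `|z - z0| < r -> `|z + d - z0| < r -> `|h (z + d) - h z| <= L * `|d|.
Proof.
move=> hC; pose N := (n + m)%:R : R; exists (N * `|grad h z0| + 1).
  by rewrite ltr_wpDl ?mulr_ge0.
near=> r => z d zr zdr.
have : `|h (z + d) - h z - slope h z0 d| <= 1 * `|d|.
  by move: z d zr zdr; near: r; apply: strict_diff.
have : `|slope h z0 d| <= N * `|grad h z0| * `|d|.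
  by apply: le_trans (dot_le_norm _ _) _; rewrite ler_wpM2l ?mulr_ge0 ?norm_col_mx.
have := ler_normD (h (z + d) - h z - slope h z0 d) (slope h z0 d).
rewrite subrK; lra.
Unshelve. all: by end_near. Qed.

End Expansions.

(** * The lower-level problem near the reference point *)

Section SmallRadii.
Variable R : realType.

Lemma near_mul_le (c e : R) : 0 < e -> \forall r \near (0 : R)^'+, c * r <= e.
Proof.
move=> e0; have [c0|c0] := leP c 0.
  apply: filterS (@nbhs_right_gt R 0) => r r0.
  by apply: le_trans (ltW e0); rewrite mulr_le0_ge0 // ltW.
near=> r; rewrite mulrC -ler_pdivlMr //; near: r; apply: nbhs_right_le.
by rewrite divr_gt0.
Unshelve. all: by end_near. Qed.

Lemma near_mul_lt (c e : R) : 0 < e -> \forall r \near (0 : R)^'+, c * r < e.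
Proof.
move=> e0; have e2 : 0 < e / 2 by rewrite divr_gt0.
by apply: filterS (near_mul_le c e2) => r; lra.
Qed.

Lemma near_witness (P : R -> Prop) :
  (\forall r \near (0 : R)^'+, P r) -> exists2 r, 0 < r & P r.
Proof.
move=> Pr; have /filter_ex[r [r0 ?]] : \forall r \near (0 : R)^'+, 0 < r /\ P r.
  by apply: filterS2 (@nbhs_right_gt R 0) Pr.
by exists r.
Qed.

Lemma enorm_sqr_diff k (a b : 'cV[R]_k) :
  `|enorm a ^+ 2 - enorm b ^+ 2| <= k%:R * `|a - b| * `|a + b|.
Proof.
have -> : enorm a ^+ 2 - enorm b ^+ 2 = dot (a - b) (a + b).
  rewrite !enorm_sqr dotBl !dotDr (dotC b a); ring.
exact: dot_le_norm.
Qed.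

Lemma enorm_sqr_conv k (y1 y2 a : 'cV[R]_k) s :
  enorm (s *: y1 + (1 - s) *: y2 - a) ^+ 2 =
    s * enorm (y1 - a) ^+ 2 + (1 - s) * enorm (y2 - a) ^+ 2
    - s * (1 - s) * enorm (y1 - y2) ^+ 2.
Proof.
rewrite !enorm_sqr !dotBl !dotBr !dotDl !dotDr !dotZl !dotZr.
rewrite (dotC y2 y1) (dotC a y1) (dotC a y2); ring.
Qed.

End SmallRadii.

Section LowerLevel.
Variables (R : realType) (n m p : nat).
Local Notation Z := ('cV[R]_n * 'cV[R]_m)%type.
Variables (f : Z -> R) (g : Z -> 'cV[R]_p) (gamma : R) (zb : Z).
Hypotheses (f_C1 : cont_diff f) (g_C1 : cont_diffv g).
Hypothesis gzb : nonpos (g zb).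

(** The common consequence of the three constraint qualifications: a weak form of
    Robinson stability, where the violation is measured by its largest component.
    The bound [theta] is positive, so that the point may be moved even where
    nothing is violated. *)
Definition correctable : Prop :=
  exists2 kappa : R, 0 < kappa & \forall r \near (0 : R)^'+,
    forall x y theta, `|(x, y) - zb| < r -> 0 < theta < r ->
      (forall i, g (x, y) i 0 <= theta) ->
      exists2 y', feas g x y' & `|y' - y| <= kappa * theta.

Definition lin_feasible (d : Z) : Prop :=
  forall i, i \in active g zb -> slope (component g i) zb d <= 0.

Hypothesis corr : correctable.

(** Following a linearized feasible direction from any feasible point near [zb]
    violates the constraints by [o(t)], hence can be corrected at cost [o(t)]. *)
Lemma feasible_step (a : 'cV[R]_n) (b : 'cV[R]_m) (e : R) :
  lin_feasible (a, b) -> 0 < e ->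
  \forall r \near (0 : R)^'+, forall x w t, `|(x, w) - zb| < r ->
    feas g x w -> 0 < t < r ->
    exists2 w', feas g (x + t *: a) w' & `|w' - (w + t *: b)| <= e * t.
Proof.
move=> linf e0; have [kappa k0 corrk] := corr; pose D := `|(a, b)|.
have D0 : 0 <= D by exact: normr_ge0.
have ek0 : 0 < e / kappa by rewrite divr_gt0.
have moved x w t r : `|(x, w) - zb| < r -> 0 < t < r ->
    `|(x + t *: a, w + t *: b) - zb| < (1 + D) * r.
  move=> xr /andP[t0 tr].
  have -> : (x + t *: a, w + t *: b) - zb = ((x, w) - zb) + t *: (a, b).
    by rewrite addrAC.
  apply: le_lt_trans (ler_normD _ _) _; rewrite normrZ gtr0_norm //.
  by rewrite mulrDl mul1r ltr_leD // [D * r]mulrC ler_wpM2r // ltW.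
have step : \forall r \near (0 : R)^'+, forall i x w t, `|(x, w) - zb| < r ->
    feas g x w -> 0 < t < r ->
    g (x + t *: a, w + t *: b) i 0 <= e / kappa * t.
  apply: filter_forall => i; have [iA|iNA] := boolP (i \in active g zb).
    have e1 : 0 < e / kappa / (D + 1) by rewrite divr_gt0 // ltr_wpDl.
    have [r1 r10 sd] := near_witness (strict_diff zb (g_C1 i) e1).
    near=> r => x w t xr xw t0r; have /andP[t0 tr] := t0r.
    have r_gt0 : 0 < r by apply: lt_trans tr.
    have rr1 : (1 + D) * r <= r1 by near: r; apply: near_mul_le.
    have := sd (x, w) (t *: (a, b)) _ _.
    rewrite slopeZ normrZ gtr0_norm // => sd'.
    have {sd'} : `|g (x + t *: a, w + t *: b) i 0 - g (x, w) i 0 -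
        t * slope (component g i) zb (a, b)| <= e / kappa / (D + 1) * (t * D).
      apply: sd'; last by apply: lt_le_trans rr1; apply: moved.
      apply: lt_le_trans xr _; apply: le_trans rr1.
      by rewrite ler_peMl ?(ltW r_gt0) // lerDl.
    rewrite ler_norml => /andP[_]; have := xw i.
    have : t * slope (component g i) zb (a, b) <= 0.
      by rewrite mulr_ge0_le0 ?(ltW t0) // linf.
    have : e / kappa / (D + 1) * (t * D) <= e / kappa * t.
      rewrite mulrCA [leRHS]mulrC ler_wpM2l ?(ltW t0) // mulrAC ler_pdivrMr ?ltr_wpDl //.
      by rewrite ler_wpM2l ?(ltW ek0) // lerDl.
    lra.
  have gi : g zb i 0 < 0.
    by rewrite lt_neqAle gzb andbT; move: iNA; rewrite inE.
  have [L L0 /near_witness[r1 r10 lip]] := lipschitz_C1 zb (g_C1 i).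
  near=> r => x w t xr xw t0r; have /andP[t0 tr] := t0r.
  have r_gt0 : 0 < r by apply: lt_trans tr.
  have rr1 : (1 + D) * r <= r1 by near: r; apply: near_mul_le.
  have rr2 : L * (1 + D) * r <= - g zb i 0.
    by near: r; apply: near_mul_le; rewrite oppr_gt0.
  have := moved _ _ _ _ xr t0r; set z := (_, _) => zr.
  have := lip zb (z - zb); rewrite subrr normr0 [zb + _]addrC subrK => /(_ r10).
  move=> /(_ (lt_le_trans zr rr1)); rewrite ler_norml => /andP[_].
  have : L * `|z - zb| <= L * ((1 + D) * r) by rewrite ler_wpM2l ?ltW.
  have : 0 <= e / kappa * t by rewrite mulr_ge0 // ltW.
  rewrite /component; lra.
have [r2 r20 corr2] := near_witness corrk.
near=> r => x w t xr xw t0r; have /andP[t0 tr] := t0r.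
have r_gt0 : 0 < r by apply: lt_trans tr.
have rr2 : (1 + D) * r <= r2 by near: r; apply: near_mul_le.
have er2 : e / kappa * r <= r2 by near: r; apply: near_mul_le.
have [||i|w' xw' ww'] := corr2 (x + t *: a) (w + t *: b) (e / kappa * t).
- by apply: lt_le_trans rr2; apply: moved.
- by rewrite mulr_gt0 //= (lt_le_trans _ er2) // ltr_pM2l.
- by move: i x w t xr xw t0r {t0 tr}; near: r.
by exists w' => //; rewrite mulrA mulrCA divff ?mulr1 ?gt_eqF in ww'.
Unshelve. all: by end_near. Qed.

Definition prox_obj (z : Z) (w : 'cV[R]_m) : R :=
  f (z.1, w) + (2 * gamma)^-1 * enorm (w - z.2) ^+ 2.

Hypothesis gamma_gt0 : 0 < gamma.

Let c := (2 * gamma)^-1.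
Let c_gt0 : 0 < c.
Proof. by rewrite invr_gt0 mulr_gt0. Qed.

Lemma prox_obj_lipschitz : exists2 C : R, 0 < C &
  \forall r \near (0 : R)^'+, forall z w z' w',
    `|z - zb| < r -> `|w - zb.2| < r -> `|z' - zb| < r -> `|w' - zb.2| < r ->
    `|prox_obj z w - prox_obj z' w'| <= C * (`|z - z'| + `|w - w'|).
Proof.
have [L L0 /near_witness[r1 r10 lip]] := lipschitz_C1 zb f_C1.
exists (L + c * m%:R * 4); first by rewrite ltr_wpDr // !mulr_ge0 // ltW.
near=> r => z w z' w' zr wr zr' wr'.
have rr1 : r <= r1 by near: r; apply: nbhs_right_le.
have r1' : r <= 1 by near: r; apply: nbhs_right_le.
set S := `|z - z'| + `|w - w'|.
have S0 : 0 <= S by rewrite addr_ge0.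
have fl : `|f (z.1, w) - f (z'.1, w')| <= L * S.
  have := lip (z'.1, w') (z.1 - z'.1, w - w').
  have -> : (z'.1, w') + (z.1 - z'.1, w - w') = (z.1, w).
    by congr pair; rewrite /= addrC subrK.
  move=> /(_ _ _)/le_trans; apply.
  - apply: lt_le_trans rr1; apply: normr_pair_lt => //.
    exact: le_lt_trans (normr_fst (z' - zb)) _.
  - apply: lt_le_trans rr1; apply: normr_pair_lt => //.
    exact: le_lt_trans (normr_fst (z - zb)) _.
  - rewrite ler_wpM2l ?(ltW L0) //; apply: normr_pair_le.
      by apply: le_trans (normr_fst (z - z')) _; rewrite lerDl.
    by rewrite lerDr.
have y2 z0 : `|z0 - zb| < r -> `|zb.2 - z0.2| < 1.
  move=> h; rewrite distrC; apply: lt_le_trans r1'.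
  exact: le_lt_trans (normr_snd (z0 - zb)) h.
have ql : `|enorm (w - z.2) ^+ 2 - enorm (w' - z'.2) ^+ 2| <= m%:R * S * 4.
  apply: le_trans (enorm_sqr_diff _ _) _; rewrite ler_pM ?mulr_ge0 //.
    rewrite ler_wpM2l //.
    have -> : w - z.2 - (w' - z'.2) = (w - w') - (z - z').2.
      by rewrite /= !opprD !opprK addrACA.
    apply: le_trans (ler_normB _ _) _; rewrite addrC lerD2r.
    exact: normr_snd.
  have nw w0 z0 : `|w0 - zb.2| < r -> `|z0 - zb| < r -> `|w0 - z0.2| <= 2.
    move=> h1 /y2 h2; rewrite -(subrK zb.2 w0) -addrA.
    apply: le_trans (ler_normD _ _) _; move: (lt_le_trans h1 r1'); lra.
  apply: le_trans (ler_normD _ _) _.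
  by have := nw _ _ wr zr; have := nw _ _ wr' zr'; lra.
rewrite /prox_obj opprD addrACA -mulrBr; apply: le_trans (ler_normD _ _) _.
rewrite normrM (gtr0_norm c_gt0) mulrDl lerD //.
by rewrite -!mulrA ler_wpM2l ?(ltW c_gt0) // [4 * _]mulrC mulrA.
Unshelve. all: by end_near. Qed.

End LowerLevel.

Section ProximalPoints.
Variables (R : realType) (n m p : nat).
Local Notation Z := ('cV[R]_n * 'cV[R]_m)%type.
Variables (f : Z -> R) (g : Z -> 'cV[R]_p) (gamma rho : R) (zb : Z).
Hypotheses (gzb : nonpos (g zb)) (rho_lt : rho < gamma^-1).

(** The common consequence of weak convexity on the graph and of weak convexity
    in the second variable: each fibre is convex and carries a [rho]-weakly convex
    restriction of [f]. *)
Definition fiber_wconvex : Prop := forall x y1 y2 s, 0 <= s <= 1 ->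
  feas g x y1 -> feas g x y2 -> let y := s *: y1 + (1 - s) *: y2 in
  feas g x y /\
  f (x, y) + rho / 2 * enorm y ^+ 2 <=
    s * (f (x, y1) + rho / 2 * enorm y1 ^+ 2)
    + (1 - s) * (f (x, y2) + rho / 2 * enorm y2 ^+ 2).

Hypothesis fib : fiber_wconvex.
Hypothesis zb_min : forall w, feas g zb.1 w -> f zb <= prox_obj f gamma zb w.

Local Notation phi := (prox_obj f gamma).
Let nu := (2 * gamma)^-1 - rho / 2.

Lemma curvature_gt0 : 0 < nu.
Proof. by rewrite /nu invfM; move: rho_lt; lra. Qed.

Lemma prox_obj_strong z y1 y2 s : 0 <= s <= 1 ->
  feas g z.1 y1 -> feas g z.1 y2 ->
  phi z (s *: y1 + (1 - s) *: y2) <=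
    s * phi z y1 + (1 - s) * phi z y2 - nu * (s * (1 - s)) * enorm (y1 - y2) ^+ 2.
Proof.
move=> s01 y1F y2F; have [_] := fib s01 y1F y2F.
rewrite /prox_obj enorm_sqr_conv.
have := enorm_sqr_conv y1 y2 0 s; rewrite !subr0 => ->.
rewrite /nu; set A := enorm _ ^+ 2; set B := enorm _ ^+ 2; set D := enorm _ ^+ 2.
set k := (2 * gamma)^-1; lra.
Qed.

(** Quadratic growth at a minimizer of a strongly convex function, obtained by
    comparing the values at [w], at [zb.2] and at their midpoint. *)
Lemma prox_obj_growth w : feas g zb.1 w ->
  f zb + nu / 2 * `|w - zb.2| ^+ 2 <= phi zb w.
Proof.
move=> wF; have zF : feas g zb.1 zb.2 by rewrite /feas /= -surjective_pairing.
have s01 : 0 <= (2^-1 : R) <= 1 by lra.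
have := prox_obj_strong s01 wF zF; have [midF _] := fib s01 wF zF.
have := zb_min midF; set mid := phi zb (_ + _).
have -> : phi zb zb.2 = f zb.
  rewrite /prox_obj subrr enorm_sqr dot0r mulr0 addr0.
  by rewrite -surjective_pairing.
have : nu * `|w - zb.2| ^+ 2 <= nu * enorm (w - zb.2) ^+ 2.
  rewrite ler_wpM2l ?(ltW curvature_gt0) //.
  by rewrite lerXn2r ?nnegrE ?enorm_ge0 ?norm_le_enorm.
lra.
Qed.

End ProximalPoints.

(** Only the candidates near [zb.2] count in the infimum that defines the envelope
    near [zb]; this replaces the continuity of the proximal map.  Were a feasible
    [w0] far from [zb.2] better than the feasible point [y0] close to [zb.2], then,
    by convexity, so would be the point of the segment from [y0] to [w0] at a fixed
    small distance from [y0]; moved back into the fibre over [zb.1], that point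
    contradicts the quadratic growth there. *)
Lemma prox_localization (R : realType) (n m p : nat)
    (f : 'cV[R]_n * 'cV[R]_m -> R) (g : 'cV[R]_n * 'cV[R]_m -> 'cV[R]_p)
    (gamma rho : R) (zb : 'cV[R]_n * 'cV[R]_m) eta :
  cont_diff f -> cont_diffv g -> nonpos (g zb) -> correctable g zb ->
  0 < gamma -> rho < gamma^-1 -> fiber_wconvex f g rho ->
  (forall w, feas g zb.1 w -> f zb <= prox_obj f gamma zb w) ->
  0 < eta ->
  \forall r \near (0 : R)^'+, forall z w0, `|z - zb| < r -> feas g z.1 w0 ->
    exists w, [/\ feas g z.1 w, prox_obj f gamma z w <= prox_obj f gamma z w0
      & `|w - zb.2| <= eta].
Proof.
move=> f_C1 g_C1 gzb corr gamma_gt0 rho_lt fib zb_min eta_gt0.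
pose nu := (2 * gamma)^-1 - rho / 2; have nu_gt0 : 0 < nu := curvature_gt0 rho_lt.
have [kappa k0 /near_witness[r1 r1_gt0 corrk]] := corr.
have [C C0 /near_witness[r2 r2_gt0 philip]] := prox_obj_lipschitz zb f_C1 gamma_gt0.
have [L [r3 [L0 r3_gt0 glip]]] : exists L r3, [/\ 0 < L, 0 < r3 &
    forall i z d, `|z - zb| < r3 -> `|z + d - zb| < r3 ->
      g (z + d) i 0 - g z i 0 <= L * `|d|].
  have Li i := lipschitz_C1 zb (g_C1 i).
  pose L i := s2val (cid2 (Li i)).
  exists (1 + \sum_i L i).
  have L_gt0 i : 0 < L i by rewrite /L; case: cid2.
  have : \forall r \near (0 : R)^'+, forall i z d, `|z - zb| < r ->
      `|z + d - zb| < r -> `|component g i (z + d) - component g i z| <= L i * `|d|.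
    by apply: filter_forall => i; rewrite /L; case: cid2.
  move=> /near_witness[r3 r3_gt0 H]; exists r3; split => //.
    by rewrite ltr_wpDr // sumr_ge0 // => i _; apply: ltW.
  move=> i z d zr zdr; apply: le_trans (ler_norm _) _.
  apply: le_trans (H i z d zr zdr) _; rewrite ler_wpM2r //.
  rewrite (bigD1 i) //= addrCA lerDl addr_ge0 // sumr_ge0 // => j _.
  exact: ltW.
(* [eta1] is the distance from [y0] at which the segment is cut *)
have /near_witness[eta1 eta1_gt0 [eta1_le eta1_r1 eta1_r2 eta1_r3]] :
    \forall e \near (0 : R)^'+,
      [/\ e <= eta / 2, 2 * e <= r1, 2 * e <= r2 & 2 * e <= r3].
  near=> e; split; near: e; try exact: near_mul_le.
  by apply: nbhs_right_le; rewrite divr_gt0.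
near=> r => z w0 zr w0F.
have r_gt0 : 0 < r by apply: le_lt_trans zr.
have rr : r < eta1 / 4 by near: r; apply: nbhs_right_lt; rewrite divr_gt0.
have Lr_r1 : L * r < r1 by near: r; apply: near_mul_lt.
have kLr : kappa * L * r <= eta1 / 4.
  by near: r; apply: near_mul_le; rewrite divr_gt0.
have Cr : C * (3 + 2 * (kappa * L)) * r < nu / 2 * (eta1 / 2) ^+ 2.
  by near: r; apply: near_mul_lt; rewrite mulr_gt0 ?divr_gt0 ?exprn_gt0 ?divr_gt0.
have [r_r1 r_r2 r_r3] : [/\ r < r1, r < r2 & r < r3].
  by move: rr (eta1_gt0) eta1_r1 eta1_r2 eta1_r3; clear; split; lra.
have xr : `|z.1 - zb.1| < r by apply: le_lt_trans (normr_fst (z - zb)) zr.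
have Lr0 : 0 < L * r < r1 by rewrite mulr_gt0.
have change x x' y : `|x - zb.1| < r -> `|x' - zb.1| < r -> `|x - x'| < r ->
    `|y - zb.2| < r3 -> feas g x' y -> forall i, g (x, y) i 0 <= L * r.
  move=> xr1 xr2 xx' yr3 yF i.
  have := glip i (x', y) (x - x', 0) _ _.
  have -> : (x', y) + (x - x', 0) = (x, y).
    by congr pair; rewrite /= ?addr0 // addrC subrK.
  have dle : `|(x - x', 0 : 'cV[R]_m)| <= r.
    by apply: normr_pair_le; rewrite ?normr0 ltW.
  move=> /(_ _ _)/le_trans h.
  have : g (x, y) i 0 - g (x', y) i 0 <= L * r.
    apply: h; last by rewrite ler_wpM2l // ltW.
      by apply: normr_pair_lt => //; apply: lt_trans r_r3.
    by apply: normr_pair_lt => //; apply: lt_trans r_r3.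
  by have := yF i; clear; lra.
have zbF : feas g zb.1 zb.2 by rewrite /feas /= -surjective_pairing.
have [y0 y0F y0c] : exists2 y0, feas g z.1 y0 & `|y0 - zb.2| <= kappa * (L * r).
  apply: corrk => //.
    apply: normr_pair_lt; rewrite ?subrr ?normr0 //=; apply: lt_trans xr r_r1.
  by apply: (change _ zb.1) => //; rewrite ?subrr ?normr0.
have y0b : `|y0 - zb.2| <= eta1 / 4 by apply: le_trans y0c _; rewrite mulrA.
have [w0near|w0far] := leP `|w0 - zb.2| eta.
  by exists w0; split.
have [y0le|y0gt] := leP (prox_obj f gamma z y0) (prox_obj f gamma z w0).
  by exists y0; split => //; move: y0b eta1_le eta_gt0; clear; lra.
exfalso.
have far : eta1 <= `|w0 - y0|.
  have := ler_normD (w0 - y0) (y0 - zb.2); rewrite addrA subrK.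
  by move: y0b w0far eta1_le (eta1_gt0); clear; lra.
have far0 : 0 < `|w0 - y0| by apply: lt_le_trans far.
pose s := eta1 / `|w0 - y0|.
have s01 : 0 <= s <= 1.
  by rewrite divr_ge0 ?(ltW eta1_gt0) //= ler_pdivrMr // mul1r.
pose w1 := s *: w0 + (1 - s) *: y0.
have w1F : feas g z.1 w1 by have [] := fib z.1 w0 y0 s s01 w0F y0F.
have w1y0 : `|w1 - y0| = eta1.
  have -> : w1 - y0 = s *: (w0 - y0).
    by rewrite /w1 scalerBl scale1r scalerBr addrCA [y0 + _]addrC addrK.
  by rewrite normrZ ger0_norm ?divfK ?gt_eqF //; case/andP: s01.
have w1le : prox_obj f gamma z w1 <= prox_obj f gamma z y0.
  have := prox_obj_strong gamma fib (z := z) s01 w0F y0F; rewrite -/w1 -/nu.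
  have : s * prox_obj f gamma z w0 <= s * prox_obj f gamma z y0.
    by apply: ler_wpM2l; [case/andP: s01|exact: ltW].
  have : 0 <= nu * (s * (1 - s)) * enorm (w0 - y0) ^+ 2.
    rewrite mulr_ge0 ?exprn_ge0 ?enorm_ge0 // mulr_ge0 ?(ltW nu_gt0) //.
    by case/andP: s01 => s0 s1; rewrite mulr_ge0 // subr_ge0.
  by clear; lra.
have w1b : `|w1 - zb.2| <= 5 / 4 * eta1.
  have := ler_normD (w1 - y0) (y0 - zb.2); rewrite addrA subrK.
  by move: w1y0 y0b; clear; lra.
have w1far : 3 / 4 * eta1 <= `|w1 - zb.2|.
  have := ler_normB (w1 - zb.2) (y0 - zb.2); rewrite opprB addrA subrK.
  by move: w1y0 y0b; clear; lra.
have [w1r1 w1r2 w1r3] :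
    [/\ `|w1 - zb.2| < r1, `|w1 - zb.2| < r2 & `|w1 - zb.2| < r3].
  by move: w1b (eta1_gt0) eta1_r1 eta1_r2 eta1_r3; clear; split; lra.
have y0r2 : `|y0 - zb.2| < r2 by move: y0b (eta1_gt0) eta1_r2; clear; lra.
have [w2 w2F w2w1] : exists2 w2, feas g zb.1 w2 & `|w2 - w1| <= kappa * (L * r).
  apply: corrk => //.
    by apply: normr_pair_lt; rewrite ?subrr ?normr0.
  by apply: (change _ z.1) => //; rewrite ?subrr ?normr0 // distrC.
have := prox_obj_growth gzb rho_lt fib zb_min w2F; rewrite -/nu.
have w2w1' : `|w2 - w1| <= eta1 / 4 by apply: le_trans w2w1 _; rewrite mulrA.
have w2far : eta1 / 2 <= `|w2 - zb.2|.
  have := ler_normD (w1 - w2) (w2 - zb.2).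
  rewrite addrA subrK [ `|w1 - w2|]distrC; move: w1far w2w1'; clear; lra.
have w2b : `|w2 - zb.2| < r2.
  have := ler_normD (w2 - w1) (w1 - zb.2); rewrite addrA subrK.
  by move: w2w1' w1b eta1_r2 (eta1_gt0); clear; lra.
have : nu / 2 * (eta1 / 2) ^+ 2 <= nu / 2 * `|w2 - zb.2| ^+ 2.
  apply: ler_wpM2l; first by rewrite ltW ?divr_gt0.
  by rewrite lerXn2r ?nnegrE // ltW // divr_gt0.
have zr2 : `|z - zb| < r2 by apply: lt_trans zr r_r2.
have p1 : prox_obj f gamma zb w2 - prox_obj f gamma z w1 <= C * (r + kappa * L * r).
  apply: le_trans (ler_norm _) _; apply: le_trans (philip _ _ _ _ _ _ _ _) _ => //.
    by rewrite subrr normr0.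
  by rewrite ler_wpM2l ?(ltW C0) // lerD // -?mulrA // distrC ltW.
have p2 : prox_obj f gamma z y0 - prox_obj f gamma zb zb.2 <= C * (r + kappa * L * r).
  apply: le_trans (ler_norm _) _; apply: le_trans (philip _ _ _ _ _ _ _ _) _ => //.
  - by rewrite subrr normr0.
  - by rewrite subrr normr0.
  by rewrite ler_wpM2l ?(ltW C0) // lerD // -?mulrA // ltW.
have : prox_obj f gamma zb zb.2 = f zb.
  rewrite /prox_obj subrr enorm_sqr dot0r mulr0 addr0.
  by rewrite -surjective_pairing.
have : 0 < C * r by rewrite mulr_gt0.
move: p1 p2 w1le Cr; clear; lra.
Unshelve. all: by end_near. Qed.

(** An upper bound for Clarke's directional derivative of the envelope at [zb]: a
    near-optimal candidate for [z] is moved along [b] and corrected.  It involves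
    the parameter [x] through [a] alone, since the quadratic term is stationary
    where the candidate equals the parameter; hence the second parameter may
    move to any [y1] at bounded speed. *)
Lemma envelope_step (R : realType) (n m p : nat)
    (f : 'cV[R]_n * 'cV[R]_m -> R) (g : 'cV[R]_n * 'cV[R]_m -> 'cV[R]_p)
    (gamma rho : R) (zb : 'cV[R]_n * 'cV[R]_m) a b (M e : R) :
  cont_diff f -> cont_diffv g -> nonpos (g zb) -> correctable g zb ->
  0 < gamma -> rho < gamma^-1 -> fiber_wconvex f g rho ->
  (forall w, feas g zb.1 w -> f zb <= prox_obj f gamma zb w) ->
  lin_feasible g zb (a, b) -> 0 < e ->
  \forall r \near (0 : R)^'+, forall z t y1 w0, `|z - zb| < r -> 0 < t < r ->
    `|y1 - z.2| <= M * t -> feas g z.1 w0 ->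
    exists2 w, feas g (z.1 + t *: a) w &
      prox_obj f gamma (z.1 + t *: a, y1) w
        <= prox_obj f gamma z w0 + t * (slope f zb (a, b) + e).
Proof.
move=> f_C1 g_C1 gzb corr gamma_gt0 rho_lt fib zb_min linf e0; pose c := (2 * gamma)^-1.
have c0 : 0 < c by rewrite invr_gt0 mulr_gt0.
pose D := `|(a, b)|; have D0 : 0 <= D by exact: normr_ge0.
pose N := (n + m)%:R * `|grad f zb|.
have N0 : 0 <= N by rewrite mulr_ge0.
(* [e1] controls the correction of the step, [e2] the remainder of [f] *)
have [e1 [e1_gt0 e1_le1 Ne1]] : exists e1, [/\ 0 < e1, e1 <= 1 & N * e1 <= e / 4].
  have /near_witness[e1 e1_gt0 []] : \forall e1 \near (0 : R)^'+,
      e1 <= 1 /\ N * e1 <= e / 4.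
    by near=> e1; split; near: e1;
      [exact: nbhs_right_le|apply: near_mul_le; rewrite divr_gt0].
  by exists e1.
pose e2 := e / 4 / (D + 1).
have e2_gt0 : 0 < e2 by rewrite !divr_gt0 // ltr_wpDl.
have De2 : e2 * (D + 1) <= e / 4 by rewrite divfK // gt_eqF // ltr_wpDl.
have [r1 r1_gt0 sd] := near_witness (strict_diff zb f_C1 e2_gt0).
have [r2 r2_gt0 step] := near_witness (feasible_step g_C1 gzb corr linf e1_gt0).
pose Q := D + 1 + `|M|.
have Q0 : 0 <= Q by rewrite !addr_ge0.
(* [r3] will bound the distance between candidate and parameter, the factor that
   makes the change of the quadratic term small *)
have /near_witness[r3 r3_gt0 [r31 r32 r3q]] : \forall r3 \near (0 : R)^'+,
    [/\ (3 + D) * r3 <= r1, 2 * r3 <= r2 & c * m%:R * Q * (4 + Q) * r3 <= e / 4].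
  by near=> r3; split; near: r3; apply: near_mul_le => //; rewrite divr_gt0.
have loc := prox_localization f_C1 g_C1 gzb corr gamma_gt0 rho_lt fib zb_min r3_gt0.
have [r4 r4_gt0 {}loc] := near_witness loc.
near=> r => z t y1 w0 zr t0r y1t w0F; have /andP[t0 tr] := t0r.
have rr3 : r <= r3 by near: r; apply: nbhs_right_le.
have rr4 : r <= r4 by near: r; apply: nbhs_right_le.
have [w [wF wle wb]] := loc z w0 (lt_le_trans zr rr4) w0F.
have xb : `|z.1 - zb.1| < r by apply: le_lt_trans (normr_fst (z - zb)) zr.
have yb : `|z.2 - zb.2| < r by apply: le_lt_trans (normr_snd (z - zb)) zr.
have xwb : `|(z.1, w) - zb| <= r3.
  by apply: normr_pair_le => //; exact: ltW (lt_le_trans xb rr3).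
have r3r2 : r3 < r2 by move: r32 (r3_gt0); clear; lra.
have [|||w' w'F w'b] := step z.1 w t => //.
- exact: le_lt_trans xwb r3r2.
- by rewrite t0 /= (lt_trans _ r3r2) // (lt_le_trans tr rr3).
exists w' => //.
pose d : 'cV[R]_n * 'cV[R]_m := (t *: a, w' - w).
have d1 : d = t *: (a, b) + (0, w' - (w + t *: b)).
  by congr pair; rewrite /= ?addr0 // [RHS]addrC opprD addrA subrK.
have resid : `|(0 : 'cV[R]_n, w' - (w + t *: b))| <= e1 * t.
  by apply: normr_pair_le => //; rewrite normr0 mulr_ge0 ?(ltW t0) // ltW.
have e1t : e1 * t <= t by rewrite ger_pMl.
have dle : `|d| <= t * (D + 1).
  rewrite d1; apply: le_trans (ler_normD _ _) _.
  by rewrite normrZ gtr0_norm // mulrDr mulr1 lerD // (le_trans resid).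
have r3D : 0 <= D * r3 by rewrite mulr_ge0 // ltW.
have tD : t * (D + 1) <= r3 * (D + 1).
  by rewrite ler_wpM2r ?addr_ge0 // ltW ?(lt_le_trans tr).
have fle : f (z.1 + t *: a, w') - f (z.1, w) <=
    t * slope f zb (a, b) + t * (e / 4) + t * (e / 4).
  have := sd (z.1, w) d; have -> : (z.1, w) + d = (z.1 + t *: a, w').
    by congr pair; rewrite /= addrC subrK.
  move=> /(_ _ _)/le_trans h.
  have {h} : `|f (z.1 + t *: a, w') - f (z.1, w) - slope f zb d| <=
      t * (e / 4).
    apply: h; first by move: xwb r31 r3D (r3_gt0); clear; lra.
      have -> : (z.1 + t *: a, w') - zb = (z.1, w) - zb + d.
        by congr pair; rewrite /= [RHS]addrAC // [w + _]addrC subrK.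
      apply: le_lt_trans (ler_normD _ _) _.
      by move: xwb dle tD r31 (r3_gt0); clear; lra.
    apply: (@le_trans _ _ (e2 * (t * (D + 1)))).
      by rewrite ler_wpM2l // ltW.
    by rewrite mulrCA ler_wpM2l // ltW.
  rewrite ler_norml => /andP[_].
  rewrite d1 slopeD slopeZ.
  have : slope f zb (0, w' - (w + t *: b)) <= t * (e / 4).
    apply: le_trans (ler_norm _) _; apply: le_trans (dot_le_norm _ _) _.
    apply: (@le_trans _ _ (N * (e1 * t))).
      by rewrite ler_wpM2l // (le_trans (norm_col_mx _)).
    by rewrite mulrA mulrC ler_wpM2l // ltW.
  by clear; lra.
have qle : c * enorm (w' - y1) ^+ 2 - c * enorm (w - z.2) ^+ 2 <= t * (e / 4).
  rewrite -mulrBr; apply: le_trans (ler_norm _) _; rewrite normrM gtr0_norm //.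
  have AB : `|w' - y1 - (w - z.2)| <= Q * t.
    have -> : w' - y1 - (w - z.2) = (w' - w) - (y1 - z.2).
      by rewrite !opprD !opprK addrACA.
    apply: le_trans (ler_normB _ _) _.
    have : `|w' - w| <= t * (D + 1) by apply: le_trans (normr_snd d) dle.
    have : M * t <= `|M| * t by rewrite ler_wpM2r ?ler_norm // ltW.
    by move: y1t; rewrite /Q; clear; lra.
  have B : `|w - z.2| <= 2 * r3.
    have := ler_normD (w - zb.2) (zb.2 - z.2); rewrite addrA subrK.
    rewrite [ `|zb.2 - _|]distrC; move: wb yb rr3; clear; lra.
  have ApB : `|w' - y1 + (w - z.2)| <= (4 + Q) * r3.
    have -> : w' - y1 + (w - z.2) = w' - y1 - (w - z.2) + (w - z.2) *+ 2.
      by rewrite mulr2n [RHS]addrA subrK.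
    apply: le_trans (ler_normD _ _) _; rewrite normrMn -mulr_natl.
    have : Q * t <= Q * r3 by rewrite ler_wpM2l // ltW ?(lt_le_trans tr).
    by move: AB B; clear; lra.
  apply: (@le_trans _ _ (c * (m%:R * (Q * t) * ((4 + Q) * r3)))).
    rewrite ler_wpM2l ?(ltW c0) //; apply: le_trans (enorm_sqr_diff _ _) _.
    by rewrite ler_pM ?mulr_ge0 // ler_wpM2l.
  have -> : c * (m%:R * (Q * t) * ((4 + Q) * r3)) =
    t * (c * m%:R * Q * (4 + Q) * r3) by ring.
  by rewrite ler_wpM2l // ltW.
have te : 0 < t * e by rewrite mulr_gt0.
move: wle fle qle te; rewrite /prox_obj /= -/c; clear; lra.
Unshelve. all: by end_near. Qed.

(** * Consequences of the convexity assumptions *)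

Section ConvexFibres.
Variable R : realType.

Lemma convex_set_combo (E : lmodType R) (C : set E) x y (s : R) :
  @convex_set R E C -> 0 <= s <= 1 -> C x -> C y -> C (s *: x + (1 - s) *: y).
Proof.
move=> Cconv /andP[s0 s1] Cx Cy.
by have := Cconv x y (Itv01 s0 s1) (mem_set Cx) (mem_set Cy); rewrite inE.
Qed.

Lemma convex_function_combo (E : lmodType R) (D : set E) (h : E -> R) x y (s : R) :
  convex_function (D : set (convex_lmodType E)) h -> 0 <= s <= 1 ->
  D x -> D y -> h (s *: x + (1 - s) *: y) <= s * h x + (1 - s) * h y.
Proof.
move=> hconv /andP[s0 s1] Dx Dy.
exact: (hconv (Itv01 s0 s1) x y (mem_set Dx) (mem_set Dy)).
Qed.

Variables (n m p : nat).
Local Notation Z := ('cV[R]_n * 'cV[R]_m)%type.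
Variables (f : Z -> R) (g : Z -> 'cV[R]_p).

Lemma feas_convex x y1 y2 (s : R) :
  (forall x i, quasiconvex (fun y : 'cV[R]_m => g (x, y) i 0)) ->
  0 <= s <= 1 -> feas g x y1 -> feas g x y2 -> feas g x (s *: y1 + (1 - s) *: y2).
Proof.
move=> qc s01 y1F y2F i.
exact: (convex_set_combo (qc x i 0) s01 (y1F i) (y2F i)).
Qed.

Lemma fiber_wconvex_fibrewise rho :
  (forall x i, quasiconvex (fun y : 'cV[R]_m => g (x, y) i 0)) ->
  (forall x, wconvex rho setT (fun y => f (x, y))) -> fiber_wconvex f g rho.
Proof.
move=> qc wc x y1 y2 s s01 y1F y2F; split; first exact: feas_convex.
by have [_ /convex_function_combo] := wc x; apply.
Qed.

Lemma pnorm_sqr (z : Z) : pnorm z ^+ 2 = enorm z.1 ^+ 2 + enorm z.2 ^+ 2.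
Proof. by rewrite !enorm_sqr dot_col_mx. Qed.

Lemma fiber_wconvex_joint rho :
  (forall x i, quasiconvex (fun y : 'cV[R]_m => g (x, y) i 0)) ->
  pwconvex rho (gph_feas g) f -> fiber_wconvex f g rho.
Proof.
move=> qc [_ wc] x y1 y2 s s01 y1F y2F; split; first exact: feas_convex.
have := convex_function_combo wc s01 (y1F : gph_feas g (x, y1)) (y2F : gph_feas g (x, y2)).
have -> : s *: (x, y1) + (1 - s) *: (x, y2) = (x, s *: y1 + (1 - s) *: y2).
  by congr pair; rewrite /= -scalerDl subrKC scale1r.
rewrite !pnorm_sqr /=; lra.
Qed.

End ConvexFibres.

(** * Constraint qualifications *)

Section Qualifications.
Variables (R : realType) (n m p : nat).
Local Notation Z := ('cV[R]_n * 'cV[R]_m)%type.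
Variables (g : Z -> 'cV[R]_p) (zb : Z).

Lemma enorm_pos_part_le (a : 'cV[R]_p) theta : 0 <= theta ->
  (forall i, a i 0 <= theta) -> enorm (pos_part a) <= p%:R * theta.
Proof.
move=> t0 at0; apply: le_trans (enorm_le_norm _) _; rewrite ler_wpM2l //.
apply: normr_cV_le => // i; rewrite mxE ger0_norm ?le_max ?lexx ?orbT //.
by rewrite ge_max at0.
Qed.

Lemma norm_le_pnorm (z : Z) : `|z| <= pnorm z.
Proof.
have e1 : enorm z.1 <= pnorm z.
  rewrite -(ler_pXn2r (n := 2)) ?nnegrE ?enorm_ge0 // pnorm_sqr lerDl.
  by rewrite exprn_ge0 ?enorm_ge0.
have e2 : enorm z.2 <= pnorm z.
  rewrite -(ler_pXn2r (n := 2)) ?nnegrE ?enorm_ge0 // pnorm_sqr lerDr.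
  by rewrite exprn_ge0 ?enorm_ge0.
rewrite [z]surjective_pairing; apply: normr_pair_le.
  exact: le_trans (norm_le_enorm _) e1.
exact: le_trans (norm_le_enorm _) e2.
Qed.

Lemma pnorm_le_norm (z : Z) : pnorm z <= (n + m)%:R * `|z|.
Proof.
by apply: le_trans (enorm_le_norm _) _; rewrite ler_wpM2l // norm_col_mx.
Qed.

Lemma RS_correctable : RS g zb -> correctable g zb.
Proof.
move=> [kappa [eps [k0 e0 rs]]]; pose K := kappa * p%:R + 1.
have K0 : 0 < K by rewrite ltr_wpDl // mulr_ge0 // ltW.
exists K => //; near=> r => x y theta xyr /andP[t0 _] gt.
have nr : n%:R * r < eps by near: r; apply: near_mul_lt.
have mr : m%:R * r < eps by near: r; apply: near_mul_lt.
have xr : `|x - zb.1| < r by apply: le_lt_trans (normr_fst ((x, y) - zb)) xyr.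
have yr : `|y - zb.2| < r by apply: le_lt_trans (normr_snd ((x, y) - zb)) xyr.
have := rs x y _ _.
have /[swap]/[apply] : enorm (x - zb.1) < eps.
  apply: le_lt_trans nr; apply: le_trans (enorm_le_norm _) _.
  by rewrite ler_wpM2l // ltW.
have /[swap]/[apply] : enorm (y - zb.2) < eps.
  apply: le_lt_trans mr; apply: le_trans (enorm_le_norm _) _.
  by rewrite ler_wpM2l // ltW.
move=> dle; have : (dist y (feas g x) < (K * theta)%:E)%E.
  apply: le_lt_trans dle _; rewrite lte_fin /K mulrDl mul1r.
  apply: le_lt_trans (_ : kappa * p%:R * theta < _); last by rewrite ltrDl.
  by rewrite -mulrA ler_wpM2l ?(ltW k0) // enorm_pos_part_le // ltW.
move=> /ereal_inf_lt[_ [y' y'F <-]]; rewrite lte_fin => yy'.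
exists y' => //; rewrite distrC; apply: le_trans (norm_le_enorm _) (ltW yy').
Unshelve. all: by end_near. Qed.

(** Gordan's alternative: the Mangasarian-Fromovitz qualification says that no
    convex combination of the active gradients vanishes, hence some direction
    decreases all active constraints at unit rate. *)
Lemma MFCQ_direction : MFCQ g zb ->
  exists e, forall i, i \in active g zb -> slope (component g i) zb (0, e) <= -1.
Proof.
move=> mfcq; pose c := col_mx (0 : 'cV[R]_m) (1%:M : 'cV[R]_1).
pose a i := if i \in active g zb then
  col_mx (grady (component g i) zb) (1%:M : 'cV[R]_1) else 0.
have [|nsep] := pselect (forall x, (forall i, dot (a i) x <= 0) -> dot c x <= 0).
  move=> /farkas_sum[lam lam0 cE]; exfalso.
  pose l : 'cV[R]_p := \col_i (if i \in active g zb then lam i else 0).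
  have sumE j : \sum_i lam i * a i j 0 =
      \sum_i l i 0 * (col_mx (grady (component g i) zb) (1%:M : 'cV[R]_1)) j 0.
    apply: eq_bigr => i _; rewrite mxE /a; case: ifP => // _.
    by rewrite mxE mul0r mulr0.
  have cj j : c j 0 = \sum_i lam i * a i j 0.
    by rewrite cE summxE; apply: eq_bigr => i _; rewrite mxE.
  have l0 : l = 0.
    apply: mfcq => [|i|].
    - apply/colP => j; have := cj (lshift 1 j); rewrite col_mxEu mxE sumE => ->.
      by rewrite mxE; apply: eq_bigr => i _; rewrite col_mxEu !mxE mulrC.
    - by rewrite mxE; case: ifP.
    - rewrite /dot big1 // => i _; rewrite !mxE; case: ifP; last by rewrite mul0r.
      by rewrite inE => /eqP ->; rewrite mulr0.
  have := cj (rshift m 0); rewrite sumE col_mxEd mxE eqxx big1 => [/eqP|i _].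
    by rewrite oner_eq0.
  by rewrite l0 mxE mul0r.
have [x ax cx] : exists2 x, forall i, dot (a i) x <= 0 & 0 < dot c x.
  apply: contrapT => nx; apply: nsep => x ax; rewrite leNgt; apply/negP => cx.
  by apply: nx; exists x.
pose s := dsubmx x 0 0.
have dotx (h : 'cV[R]_m) : dot (col_mx h (1%:M : 'cV[R]_1)) x = dot h (usubmx x) + s.
  rewrite -[x in LHS]vsubmxK dot_col_mx; congr (_ + _).
  by rewrite /dot big_ord1 mxE eqxx mul1r.
have s0 : 0 < s by move: cx; rewrite dotx dotC dot0r add0r.
exists (s^-1 *: usubmx x) => i iA.
have := ax i; rewrite /a iA dotx => h.
rewrite /slope dot_col_mx dot0r add0r dotZr mulrC ler_pdivrMr // mulN1r.
by rewrite -subr_le0 opprK.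
Qed.

Lemma MFCQ_correctable : cont_diffv g -> nonpos (g zb) -> MFCQ g zb ->
  correctable g zb.
Proof.
move=> gC gzb /MFCQ_direction[e de]; pose E := `|e|.
have E0 : 0 <= E by exact: normr_ge0.
exists (2 * E + 1); first by rewrite ltr_wpDl // mulr_ge0.
have moved x y theta r : `|(x, y) - zb| < r -> 0 < theta < r ->
    `|(x, y + (2 * theta) *: e) - zb| < (1 + 2 * E) * r.
  move=> xr /andP[t0 tr].
  have -> : (x, y + (2 * theta) *: e) - zb = ((x, y) - zb) + (2 * theta) *: (0, e).
    by congr pair; rewrite /= 1?addrAC // scaler0 addr0.
  apply: le_lt_trans (ler_normD _ _) _; rewrite normrZ gtr0_norm ?mulr_gt0 //.
  have -> : `|(0 : 'cV[R]_n, e)| = E.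
    by rewrite prod_normE /= normr0 max_r.
  have : 2 * E * theta <= 2 * E * r by rewrite ler_wpM2l ?mulr_ge0 // ltW.
  lra.
have step : \forall r \near (0 : R)^'+, forall i x y theta, `|(x, y) - zb| < r ->
    0 < theta < r -> g (x, y) i 0 <= theta ->
    g (x, y + (2 * theta) *: e) i 0 <= 0.
  apply: filter_forall => i; have [iA|iNA] := boolP (i \in active g zb).
    have e1 : 0 < (2 * (E + 1))^-1 by rewrite invr_gt0 mulr_gt0 // ltr_wpDl.
    have [r1 r10 sd] := near_witness (strict_diff zb (gC i) e1).
    near=> r => x y theta xr t0r gt; have /andP[t0 tr] := t0r.
    have r_gt0 : 0 < r by apply: lt_trans tr.
    have rr1 : (1 + 2 * E) * r <= r1 by near: r; apply: near_mul_le.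
    have := sd (x, y) (2 * theta *: (0, e)) _ _.
    have -> : (x, y) + 2 * theta *: (0, e) = (x, y + (2 * theta) *: e).
      by congr pair; rewrite /= ?scaler0 ?addr0.
    rewrite slopeZ normrZ gtr0_norm ?mulr_gt0 // => sd'.
    have {sd'} := sd' _ _; have /[swap]/[apply] : `|(x, y) - zb| < r1.
      apply: lt_le_trans xr _; apply: le_trans rr1.
      by rewrite ler_peMl ?(ltW r_gt0) // lerDl mulr_ge0.
    have /[swap]/[apply] := lt_le_trans (moved _ _ _ _ xr t0r) rr1.
    have -> : `|(0 : 'cV[R]_n, e)| = E.
      by rewrite prod_normE /= normr0 max_r.
    rewrite ler_norml => /andP[_].
    have : 2 * theta * slope (component g i) zb (0, e) <= 2 * theta * -1.
      by rewrite ler_wpM2l ?de // mulr_ge0 // ltW.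
    have : (2 * (E + 1))^-1 * (2 * theta * E) <= theta.
      rewrite mulrC ler_pdivrMr ?mulr_gt0 // ?ltr_wpDl //; lra.
    rewrite /component; lra.
  have gi : g zb i 0 < 0.
    by rewrite lt_neqAle gzb andbT; move: iNA; rewrite inE.
  have [L L0 /near_witness[r1 r10 lip]] := lipschitz_C1 zb (gC i).
  near=> r => x y theta xr t0r _.
  have rr1 : (1 + 2 * E) * r <= r1 by near: r; apply: near_mul_le.
  have rr2 : L * (1 + 2 * E) * r <= - g zb i 0.
    by near: r; apply: near_mul_le; rewrite oppr_gt0.
  have := moved _ _ _ _ xr t0r; set z := (_, _) => zr.
  have := lip zb (z - zb); rewrite subrr normr0 [zb + _]addrC subrK => /(_ r10).
  move=> /(_ (lt_le_trans zr rr1)); rewrite ler_norml => /andP[_].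
  have : L * `|z - zb| <= L * ((1 + 2 * E) * r) by rewrite ler_wpM2l ?ltW.
  rewrite /component; lra.
near=> r => x y theta xr t0r gt; have /andP[t0 tr] := t0r.
exists (y + (2 * theta) *: e).
  by move=> i; move: (gt i); move: i x y theta xr t0r {gt t0 tr}; near: r.
rewrite addrAC subrr add0r normrZ gtr0_norm ?mulr_gt0 //.
rewrite -/E; lra.
Unshelve. all: by end_near. Qed.

End Qualifications.

Section JointConvexity.
Variables (R : realType) (n m p : nat).
Local Notation Z := ('cV[R]_n * 'cV[R]_m)%type.
Implicit Types (C : set Z) (zb : Z).

Definition combo_closed C := forall z w (s : R), 0 <= s <= 1 -> C z -> C w ->
  C (s *: z + (1 - s) *: w).

(** Induction on the coordinates that are allowed to vary: [x + c e_j + d] is the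
    midpoint of [x + 2 c e_j], which lies on a fixed segment parallel to [e_j] and
    over which convexity provides bounded points, and of [x + 2 d]. *)
Lemma bounded_fibres_cube C zb delta : combo_closed C -> C zb -> 0 < delta ->
  (forall x, `|x - zb.1| < delta -> exists y, C (x, y)) ->
  forall s : seq 'I_n, exists r M : R, [/\ 0 < r, 0 <= M &
    forall c : 'I_n -> R, (forall i, `|c i| <= r) -> exists2 y,
      C (zb.1 + \sum_(i <- s) c i *: delta_mx i 0, y) & `|y - zb.2| <= M].
Proof.
move=> Cc Czb d0 Cne; elim=> [|j s [r [M [r0 M0 IH]]]].
  exists 1, 0; split => // c _; exists zb.2; last by rewrite subrr normr0.
  by rewrite big_nil addr0 -surjective_pairing.
pose h := delta / 2; have h0 : 0 < h by rewrite divr_gt0.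
pose e : 'cV[R]_n := delta_mx j 0.
have ne : `|e| <= 1.
  by apply: normr_cV_le => // i; rewrite mxE; case: (_ && _); rewrite ?normr1 ?normr0.
have end_point (t : R) : `|t| = h -> exists y, C (zb.1 + t *: e, y).
  move=> th; apply: Cne; rewrite addrAC subrr add0r normrZ th.
  have : h * `|e| <= h by rewrite ger_pMr.
  rewrite /h; lra.
have [yp Cp] := end_point h (gtr0_norm h0).
have [ym Cm] : exists y, C (zb.1 + (- h) *: e, y).
  by apply: end_point; rewrite normrN gtr0_norm.
pose K := `|yp - zb.2| + `|ym - zb.2|.
have K0 : 0 <= K by rewrite addr_ge0.
exists (Num.min (r / 2) (h / 2)), (M + K); split.
- by rewrite lt_min !divr_gt0.
- by rewrite addr_ge0.
move=> c cr.
have ch i : `|c i| <= h / 2 by apply: le_trans (cr i) _; rewrite ge_min lexx orbT.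
have cr' i : `|2 * c i| <= r.
  rewrite normrM ger0_norm //; have : `|c i| <= r / 2.
    by apply: le_trans (cr i) _; rewrite ge_min lexx.
  lra.
have [y Cy yM] := IH (fun i => 2 * c i) cr'.
have cjb : - h <= 2 * c j <= h by have := ch j; rewrite ler_norml; lra.
have [l l01 lE] : exists2 l, 0 <= l <= 1 & 2 * h * l = 2 * c j + h.
  exists ((2 * c j + h) / (2 * h)).
    by rewrite ler_pdivlMr ?ler_pdivrMr ?mulr_gt0 //; lra.
  by rewrite mulrC divfK // gt_eqF // mulr_gt0.
pose y1 := l *: yp + (1 - l) *: ym; have := Cc _ _ _ l01 Cp Cm.
have -> : l *: (zb.1 + h *: e, yp) + (1 - l) *: (zb.1 + - h *: e, ym) =
    (zb.1 + (2 * c j) *: e, y1).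
  congr pair; rewrite /= !scalerDr addrACA -scalerDl subrKC scale1r.
  by congr (_ + _); rewrite !scalerA -scalerDl; congr (_ *: _); lra.
move=> C1; have half : 0 <= (2^-1 : R) <= 1 by lra.
have halfC : 1 - 2^-1 = 2^-1 :> R by lra.
have := Cc _ _ _ half C1 Cy; rewrite halfC.
have -> : 2^-1 *: (zb.1 + (2 * c j) *: e, y1) +
    2^-1 *: (zb.1 + \sum_(i <- s) (2 * c i) *: delta_mx i 0, y) =
    (zb.1 + \sum_(i <- j :: s) c i *: delta_mx i 0, 2^-1 *: y1 + 2^-1 *: y).
  congr pair; rewrite /= -scalerDr addrACA -mulr2n -[zb.1 *+ 2]scaler_nat scalerDr.
  rewrite scalerA mulVf // scale1r; congr (_ + _); rewrite big_cons scalerDr.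
  rewrite scalerA mulKf //; congr (_ + _).
  rewrite scaler_sumr; apply: eq_bigr => i _; by rewrite scalerA mulKf.
move=> C2; exists (2^-1 *: y1 + 2^-1 *: y) => //.
have y1K : `|y1 - zb.2| <= K.
  have -> : y1 - zb.2 = l *: (yp - zb.2) + (1 - l) *: (ym - zb.2).
    by rewrite !scalerBr addrACA -opprD -scalerDl subrKC scale1r.
  apply: le_trans (ler_normD _ _) _; rewrite !normrZ.
  case/andP: l01 => l0 l1; rewrite !ger0_norm ?subr_ge0 //.
  by rewrite lerD // ler_piMl // gerBl.
have -> : 2^-1 *: y1 + 2^-1 *: y - zb.2 = 2^-1 *: (y1 - zb.2) + 2^-1 *: (y - zb.2).
  rewrite !scalerBr addrACA -opprD -scalerDl.
  by rewrite -[in LHS](scale1r zb.2); congr (_ - _ *: _); lra.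
apply: le_trans (ler_normD _ _) _; rewrite !normrZ ger0_norm ?invr_ge0 //.
lra.
Qed.

Lemma bounded_fibres C zb delta : combo_closed C -> C zb -> 0 < delta ->
  (forall x, `|x - zb.1| < delta -> exists y, C (x, y)) ->
  exists r M : R, [/\ 0 < r, 0 <= M & forall x, `|x - zb.1| <= r ->
    exists2 y, C (x, y) & `|y - zb.2| <= M].
Proof.
move=> Cc Czb d0 /(bounded_fibres_cube Cc Czb d0) /(_ (index_enum 'I_n)).
move=> [r [M [r0 M0 H]]]; exists r, M; split => // x xr.
have [i|y] := H (fun i => (x - zb.1) i 0); first exact: le_trans (normr_coord _ _) xr.
suff -> : \sum_i (x - zb.1) i 0 *: delta_mx i 0 = x - zb.1.
  by rewrite addrC subrK => ? ?; exists y.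
by rewrite [RHS]matrix_sum_delta; apply: eq_bigr => i _; rewrite big_ord1.
Qed.

Variables (g : Z -> 'cV[R]_p) (zb : Z).

(** The pair provided by MSCQ is feasible for a slightly wrong parameter.  A
    convex combination with a point of bounded size, over a parameter lying beyond
    the wanted one, restores the parameter; its weight is proportional to the
    error. *)
Lemma MSCQ_correctable : (forall i, quasiconvex (component g i)) ->
  nonpos (g zb) -> (\forall x \near zb.1, feas g x !=set0) -> MSCQ g zb ->
  correctable g zb.
Proof.
move=> qc gzb /nbhs_normP[delta /= d0 ne] [eps [kappa [e0 k0 mscq]]].
pose C : set Z := [set z | nonpos (g z)].
have Cc : combo_closed C.
  by move=> z w s s01 Cz Cw i; apply: (convex_set_combo (qc i 0) s01 (Cz i) (Cw i)).
have [|r1 [M [r10 M0 bf]]] := bounded_fibres Cc gzb d0.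
  by move=> x xd; have [|y] := ne x; [rewrite /= distrC|exists y].
pose K := kappa * p%:R + 1.
have K0 : 0 < K by rewrite ltr_wpDl // mulr_ge0 // ltW.
pose T := 2 * K / r1; have T0 : 0 < T by rewrite divr_gt0 // mulr_gt0.
exists (K + T * (M + 1)); first by rewrite ltr_wpDr // mulr_ge0 ?(ltW T0) // addr_ge0.
near=> r => x y theta xyr t0r gt; have /andP[t0 tr] := t0r.
have r_gt0 : 0 < r by apply: lt_trans tr.
have pr : (n + m)%:R * r < eps by near: r; apply: near_mul_lt.
have Tr : T * r <= 1 by near: r; apply: near_mul_le.
have Kr : (1 + K) * r <= r1 / 2 by near: r; apply: near_mul_le; rewrite divr_gt0.
have Kr1 : (1 + K) * r <= 1 by near: r; apply: near_mul_le.
have Kt : K * theta <= K * r by rewrite ler_wpM2l // ltW.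
have := mscq (x, y) _.
have /[swap]/[apply] : pnorm ((x, y) - zb) < eps.
  apply: le_lt_trans pr; apply: le_trans (pnorm_le_norm _) _.
  by rewrite ler_wpM2l // ltW.
move=> dle; have : (pdist (x, y) [set w | nonpos (g w)] < (K * theta)%:E)%E.
  apply: le_lt_trans dle _; rewrite lte_fin /K mulrDl mul1r.
  apply: le_lt_trans (_ : kappa * p%:R * theta < _); last by rewrite ltrDl.
  by rewrite -mulrA ler_wpM2l ?(ltW k0) // enorm_pos_part_le // ltW.
move=> /ereal_inf_lt[_ [z' z'C <-]]; rewrite lte_fin => zz'.
have {zz'} zz' : `|(x, y) - z'| <= K * theta.
  exact: le_trans (norm_le_pnorm _) (ltW zz').
have xx' : `|x - z'.1| <= K * theta by apply: le_trans (normr_fst ((x, y) - z')) zz'.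
have yy' : `|y - z'.2| <= K * theta by apply: le_trans (normr_snd ((x, y) - z')) zz'.
have xr : `|x - zb.1| < r by apply: le_lt_trans (normr_fst ((x, y) - zb)) xyr.
have yr : `|y - zb.2| < r by apply: le_lt_trans (normr_snd ((x, y) - zb)) xyr.
pose tau := T * theta; have tau0 : 0 < tau by rewrite mulr_gt0.
have tau01 : 0 <= tau <= 1.
  by rewrite ltW //= (le_trans _ Tr) // ler_wpM2l // ltW.
(* [x2] is chosen so that [x = (1 - tau) z'.1 + tau x2] *)
pose x2 := z'.1 + tau^-1 *: (x - z'.1).
have [|y2 Cy2 y2M] := bf x2.
  have -> : x2 - zb.1 = (tau^-1 *: (x - z'.1) - (x - z'.1)) + (x - zb.1).
    by rewrite /x2 opprB -[RHS]addrA [z'.1 - x + _]addrA subrK [RHS]addrCA addrA.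
  have half : `|tau^-1 *: (x - z'.1)| <= r1 / 2.
    rewrite normrZ gtr0_norm ?invr_gt0 // mulrC ler_pdivrMr //.
    apply: le_trans xx' _; rewrite le_eqVlt; apply/orP; left; apply/eqP.
    by rewrite /tau /T; field; rewrite gt_eqF.
  apply: le_trans (ler_normD _ _) _.
  have := ler_normB (tau^-1 *: (x - z'.1)) (x - z'.1); lra.
pose y1 := tau *: y2 + (1 - tau) *: z'.2.
have := Cc _ _ _ tau01 Cy2 (z'C : C z').
have -> : tau *: (x2, y2) + (1 - tau) *: z' = (x, y1).
  congr pair; rewrite /= /x2 scalerDr scalerA divff ?gt_eqF // scale1r addrAC.
  by rewrite -scalerDl subrKC scale1r addrC subrK.
move=> Cy1; exists y1 => //.
have -> : y1 - y = tau *: (y2 - z'.2) + (z'.2 - y).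
  by rewrite /y1 scalerBl scale1r scalerBr [RHS]addrA addrCA [z'.2 + _]addrC.
apply: le_trans (ler_normD _ _) _; rewrite normrZ gtr0_norm // [ `|z'.2 - y|]distrC.
have y2z : `|y2 - z'.2| <= M + 1.
  have := ler_normD (y2 - zb.2) (zb.2 - y + (y - z'.2)).
  rewrite [zb.2 - y + _]addrA subrK addrA subrK.
  have := ler_normD (zb.2 - y) (y - z'.2); rewrite addrA subrK [ `|zb.2 - y|]distrC; lra.
have : tau * `|y2 - z'.2| <= tau * (M + 1) by rewrite ler_wpM2l // ltW.
rewrite /tau; lra.
Unshelve. all: by end_near. Qed.

End JointConvexity.

(** * Stationarity *)

Section Directions.
Variables (R : realType) (n m : nat).
Local Notation Z := ('cV[R]_n * 'cV[R]_m)%type.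

Lemma pnormD (z w : Z) : pnorm (z + w) <= pnorm z + pnorm w.
Proof. by rewrite /pnorm -add_col_mx enorm_triangle. Qed.

Lemma pnormZ t (z : Z) : pnorm (t *: z) = `|t| * pnorm z.
Proof. by rewrite /pnorm -scale_col_mx enormZ. Qed.

Lemma pnormN (z : Z) : pnorm (- z) = pnorm z.
Proof. by rewrite -scaleN1r pnormZ normrN1 mul1r. Qed.

(** The directional neighbourhood contains, near 0, a cone around the ray spanned by
    [d]; for [d = 0] the directional condition is void. *)
Lemma dir_nbhd_cone (d : Z) (delta : R) : 0 < delta ->
  exists2 tau, 0 < tau & forall t z, 0 < t -> pnorm (z - t *: d) <= tau * t ->
    pnorm (pnorm d *: z - pnorm z *: d) <= delta * pnorm z * pnorm d.
Proof.
move=> delta0; have P0 : 0 <= pnorm d by exact: enorm_ge0.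
have [Pd0|PN0] := eqVneq (pnorm d) 0.
  exists 1 => // t z _ _; rewrite Pd0 mulr0.
  have -> : d = 0.
    by apply/eqP; rewrite -normr_eq0 eq_le normr_ge0 -Pd0 norm_le_pnorm.
  by rewrite scale0r scaler0 subrr -(scale0r 0) pnormZ normr0 mul0r.
have P_gt0 : 0 < pnorm d by rewrite lt_neqAle eq_sym PN0.
pose P := pnorm d; exists (delta * P / (2 + delta)).
  by rewrite divr_gt0 ?mulr_gt0 // addr_gt0.
move=> t z t0; set e := z - t *: d => He.
have He2 : (2 + delta) * pnorm e <= delta * P * t.
  have : (2 + delta) * pnorm e <= (2 + delta) * (delta * P / (2 + delta) * t).
    by rewrite ler_wpM2l // addr_ge0 // ltW.
  by rewrite mulrA mulrCA divff ?mulr1 // gt_eqF // addr_gt0.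
have zE : z = t *: d + e by rewrite addrC subrK.
have zle : pnorm z <= t * P + pnorm e.
  by rewrite zE; apply: le_trans (pnormD _ _) _; rewrite pnormZ gtr0_norm.
have zge : t * P - pnorm e <= pnorm z.
  have := pnormD z (- e); rewrite pnormN {1}zE addrK pnormZ gtr0_norm //.
  rewrite -/P; lra.
have -> : pnorm d *: z - pnorm z *: d = P *: e + (t * P - pnorm z) *: d.
  by rewrite -/P {1}zE scalerDr scalerA mulrC scalerBl addrAC addrA [_ + P *: e]addrC addrA.
apply: le_trans (pnormD _ _) _; rewrite !pnormZ (gtr0_norm P_gt0) -/P.
have : `|t * P - pnorm z| * P <= pnorm e * P.
  by rewrite ler_wpM2r // ler_norml; lra.
have : P * (2 * pnorm e) <= P * (delta * pnorm z).
  rewrite ler_wpM2l //.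
  have : delta * (t * P - pnorm e) <= delta * pnorm z by rewrite ler_wpM2l // ltW.
  lra.
lra.
Qed.

(** A limit superior is attained approximately at arbitrarily small [t]. *)
Lemma upper_dini_step (psi : Z -> \bar R) (z d : Z) (a c e r : R) :
  psi z = a%:E -> (c%:E <= upper_dini psi z d)%E -> 0 < e -> 0 < r ->
  exists2 t, 0 < t < r & ((a + t * (c - e))%:E <= psi (z + t *: d)%R)%E.
Proof.
move=> psiz cle e0 r0; apply: contrapT => nt.
have : (upper_dini psi z d <= (c - e)%:E)%E.
  apply: ge_ereal_inf; exists (ereal_sup [set ((t^-1)%:E *
      (psi (z + t *: d)%R - psi z))%E | t in [set t : R | 0 < t < r]]).
    exists [set t : R | 0 < t < r] => //; near=> t; apply/andP; split.
      by near: t; apply: nbhs_right_gt.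
    by near: t; apply: nbhs_right_lt.
  apply: ge_ereal_sup => _ [t /= t0r <-]; have /andP[t0 _] := t0r.
  have : ~ ((a + t * (c - e))%:E <= psi (z + t *: d)%R)%E by move=> h; apply: nt; exists t.
  move=> /negP; rewrite -ltNge psiz; case: (psi _) => [x| |] //=.
    rewrite -EFinD -EFinM lte_fin lee_fin => h.
    by rewrite mulrC ler_pdivrMr //; lra.
  by move=> _; rewrite gt0_muleNy ?leNye // lte_fin invr_gt0.
move=> /(le_trans cle); rewrite lee_fin; lra.
Unshelve. all: by end_near. Qed.

Lemma expansion_along (h : Z -> R) (z d : Z) : cont_diff h ->
  exists2 K, 0 < K & forall e, 0 < e <= 1 -> \forall r \near (0 : R)^'+,
    forall t (b : 'cV[R]_m), 0 < t < r -> `|b| <= e * t ->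
      `|h (z + (t *: d + (0, b))) - h z - t * slope h z d| <= K * e * t.
Proof.
move=> hC; pose N := (n + m)%:R * `|grad h z|.
have N0 : 0 <= N by rewrite mulr_ge0.
exists (N + `|d| + 1); first by rewrite ltr_wpDl // addr_ge0.
move=> e /andP[e0 e1]; have [r1 r10 sd] := near_witness (strict_diff z hC e0).
near=> r => t b /andP[t0 tr] be.
have dr : (`|d| + 1) * r < r1 by near: r; apply: near_mul_lt.
have b0 : `|(0 : 'cV[R]_n, b)| <= e * t.
  by apply: normr_pair_le => //; rewrite normr0 mulr_ge0 // ltW.
set w := t *: d + (0, b); have wle : `|w| <= (`|d| + 1) * t.
  apply: le_trans (ler_normD _ _) _; rewrite normrZ gtr0_norm //.
  have : e * t <= t by rewrite ger_pMl.
  lra.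
have := sd z w; rewrite subrr normr0 addrAC subrr add0r => /(_ r10).
have /[swap]/[apply] : `|w| < r1.
  by apply: le_lt_trans wle _; apply: lt_trans dr; rewrite ltr_pM2l // ltr_wpDl.
rewrite slopeD slopeZ => h1.
have h2 : `|slope h z (0, b)| <= N * (e * t).
  apply: le_trans (dot_le_norm _ _) _.
  by rewrite ler_wpM2l // (le_trans (norm_col_mx _)).
have h3 : e * `|w| <= e * ((`|d| + 1) * t) by rewrite ler_wpM2l // ltW.
have -> : h (z + w) - h z - t * slope h z d =
    h (z + w) - h z - (t * slope h z d + slope h z (0, b)) + slope h z (0, b).
  by ring.
apply: le_trans (ler_normD _ _) _; lra.
Unshelve. all: by end_near. Qed.

End Directions.

Section KKT.
Variables (R : realType) (n m p q : nat).
Local Notation Z := ('cV[R]_n * 'cV[R]_m)%type.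
Variables (F f : Z -> R) (G : Z -> 'cV[R]_q) (g : Z -> 'cV[R]_p) (zb : Z).

Lemma jac_slope k (h : Z -> 'cV[R]_k) (z d : Z) i :
  (jac h z *m col_mx d.1 d.2) i 0 = slope (component h i) z d.
Proof. by rewrite mxE; apply: eq_bigr => j _; rewrite mxE. Qed.

Lemma jacy_slope k (h : Z -> 'cV[R]_k) (z : Z) (e : 'cV[R]_m) i :
  (jacy h z *m e) i 0 = slope (component h i) z (0, e).
Proof.
rewrite /slope dot_col_mx dot0r add0r mxE.
by apply: eq_bigr => j _; rewrite mxE.
Qed.

(** With [mu = rho * lambda] the optimality system of the problem penalized by
    [rho] is linear in the multipliers, so Farkas' lemma applies.  A dual
    certificate consists of a linearized feasible direction [d] and of a vector
    [e] for which the lower-level constraints can be followed back along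
    [(- d.1, e - d.2)]; by the bound on the envelope, [slope f zb (0, e)] is then an
    upper bound for the slope of [f] minus the envelope along [d]. *)
Lemma kkt_alternative (rho : R) :
  (exists lg lG mu, [/\ nonneg lg /\ dot lg (g zb) = 0,
     nonneg lG /\ dot lG (G zb) = 0, nonneg mu /\ dot (g zb) mu = 0,
     0 = grad F zb + (jac g zb)^T *m (lg - mu) + (jac G zb)^T *m lG &
     rho *: grady f zb + (jacy g zb)^T *m mu = 0]) \/
  (exists d e, [/\ lin_feasible g zb d, lin_feasible G zb d,
     lin_feasible g zb (- d.1, e - d.2) &
     slope F zb d + rho * slope f zb (0, e) < 0]).
Proof.
pose mask k (h : Z -> 'cV[R]_k) : 'M[R]_k :=
  diag_mx (\row_i (i \in active h zb)%:R).
have maskE k (h : Z -> 'cV[R]_k) (l : 'cV[R]_k) i :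
    (mask k h *m l) i 0 = if i \in active h zb then l i 0 else 0.
  by rewrite mul_diag_mx !mxE; case: ifP; rewrite ?mul1r ?mul0r.
have mask_ge0 k (h : Z -> 'cV[R]_k) l : nonneg l -> nonneg (mask k h *m l).
  by move=> l0 i; rewrite maskE; case: ifP.
have mask_dot k (h : Z -> 'cV[R]_k) l : dot (mask k h *m l) (h zb) = 0.
  rewrite /dot big1 // => i _; rewrite maskE; case: ifP; last by rewrite mul0r.
  by rewrite inE => /eqP ->; rewrite mulr0.
pose Jg := (jac g zb)^T *m mask p g; pose JG := (jac G zb)^T *m mask q G.
pose Jy := (jacy g zb)^T *m mask p g.
pose A := block_mx (row_mx Jg JG) (- Jg) 0 Jy.
have [[x x0]|[x xA]] := farkas A (col_mx (- grad F zb) (- (rho *: grady f zb))).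
  rewrite -[x]vsubmxK -[usubmx x]vsubmxK mul_block_col mul_row_col mul0mx add0r.
  set l1 := usubmx (usubmx x); set l2 := dsubmx (usubmx x); set mu := dsubmx x.
  have l1_ge0 : nonneg l1 by move=> i; rewrite !mxE.
  have l2_ge0 : nonneg l2 by move=> i; rewrite !mxE.
  have mu_ge0 : nonneg mu by move=> i; rewrite !mxE.
  move=> /eq_col_mx[E1 E2]; left.
  exists (mask p g *m l1), (mask q G *m l2), (mask p g *m mu); split.
  - by split; [apply: mask_ge0|apply: mask_dot].
  - by split; [apply: mask_ge0|apply: mask_dot].
  - by split; [apply: mask_ge0|rewrite dotC mask_dot].
  - rewrite mulmxBr !mulmxA -/Jg -/JG -addrA [X in _ + X]addrAC.
    by rewrite -[- (Jg *m mu)]mulNmx E1 subrr.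
  - by rewrite mulmxA -/Jy E2 subrr.
rewrite -[x]vsubmxK dot_col_mx => cx; right.
pose d : Z := (usubmx (usubmx x), dsubmx (usubmx x)); pose e := dsubmx x.
have dE : usubmx x = col_mx d.1 d.2 by rewrite vsubmxK.
move: xA; rewrite -[x]vsubmxK tr_block_mx mul_block_col tr_row_mx trmx0 mul0mx addr0.
rewrite mul_col_mx dE linearN /= mulNmx.
have trE k (h : Z -> 'cV[R]_k) (M : 'M[R]_(k, n + m)) :
    ((M^T *m mask k h)^T = mask k h *m M).
  by rewrite trmx_mul trmxK tr_diag_mx.
rewrite /Jg /JG !trE => xA.
have linE k (h : Z -> 'cV[R]_k) : nonpos (mask k h *m jac h zb *m col_mx d.1 d.2) ->
    lin_feasible h zb d.
  by move=> H i iA; have := H i; rewrite -mulmxA maskE iA jac_slope.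
have xA1 : nonpos (mask p g *m jac g zb *m col_mx d.1 d.2).
  by move=> i; have := xA (lshift p (lshift q i)); rewrite !col_mxEu.
have xA2 : nonpos (mask q G *m jac G zb *m col_mx d.1 d.2).
  by move=> i; have := xA (lshift p (rshift p i)); rewrite col_mxEu col_mxEd.
exists d, e; split.
- exact: linE.
- exact: linE.
- move=> i iA; have := xA (rshift (p + q) i); rewrite col_mxEd mxE.
  rewrite /Jy trmx_mul trmxK tr_diag_mx -!mulmxA [X in X + _]mxE !maskE iA.
  rewrite (jac_slope g zb d) jacy_slope.
  have -> : (- d.1, e - d.2) = - d + (0, e).
    by congr pair; rewrite /= ?addr0 // addrC.
  by rewrite slopeD slopeN.
- move: cx; rewrite dE !dotNl dotZl -/e.
  have -> : dot (grady f zb) e = slope f zb (0, e).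
    by rewrite /slope dot_col_mx dot0r add0r.
  rewrite -/(slope F zb d); lra.
Qed.

End KKT.

(** Along a linearized feasible direction the active constraints grow at most like
    the error term; the inactive ones stay negative. *)
Lemma constraints_along (R : realType) (n m k : nat)
    (G : 'cV[R]_n * 'cV[R]_m -> 'cV[R]_k) (z h : 'cV[R]_n * 'cV[R]_m) :
  cont_diffv G -> nonpos (G z) -> lin_feasible G z h ->
  exists2 K, 0 < K & forall e, 0 < e <= 1 -> \forall r \near (0 : R)^'+,
    forall i t (b : 'cV[R]_m), 0 < t < r -> `|b| <= e * t ->
      G (z + (t *: h + (0, b))) i 0 <= K * e * t.
Proof.
move=> G_C1 Gz Gh; have expi i := expansion_along z h (G_C1 i).
pose K i := s2val (cid2 (expi i)).
have K0 i : 0 < K i by rewrite /K; case: cid2.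
pose S := 1 + \sum_i K i.
exists S; first by rewrite ltr_wpDr // sumr_ge0 // => i _; apply: ltW.
move=> e e01; apply: filter_forall => i; have /andP[e0 _] := e01.
have KiS : K i <= S.
  rewrite /S (bigD1 i) //= addrCA lerDl addr_ge0 // sumr_ge0 // => j _.
  exact: ltW.
pose sl := slope (component G i) z h.
have H : \forall r \near (0 : R)^'+, forall t (b : 'cV[R]_m), 0 < t < r ->
    `|b| <= e * t -> G (z + (t *: h + (0, b))) i 0 <= G z i 0 + t * sl + S * e * t.
  have : \forall r \near (0 : R)^'+, forall t (b : 'cV[R]_m), 0 < t < r ->
      `|b| <= e * t -> `|component G i (z + (t *: h + (0, b))) -
        component G i z - t * sl| <= K i * e * t.
    by rewrite /K; case: cid2 => /= c _; apply.
  apply: filterS => r H t b t0r bt; have /andP[t0 _] := t0r.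
  have KS : K i * e * t <= S * e * t by rewrite !ler_wpM2r // ltW.
  move: (le_trans (H t b t0r bt) KS); rewrite ler_norml /component => /andP[_].
  by move: (S * e * t) => c; clear; lra.
have [iA|iNA] := boolP (i \in active G z).
  apply: filterS H => r H t b t0r bt; apply: le_trans (H t b t0r bt) _.
  have /andP[t0 _] := t0r; rewrite gerDr -[leRHS]addr0 lerD ?Gz //.
  by rewrite mulr_ge0_le0 ?(ltW t0) // Gh.
have Gi : 0 < - G z i 0.
  by rewrite oppr_gt0 lt_neqAle Gz andbT; move: iNA; rewrite inE.
near=> r => t b t0r bt; have /andP[t0 tr] := t0r.
apply: (@le_trans _ _ (G z i 0 + t * sl + S * e * t)).
  by move: t b t0r bt {t0 tr}; near: r.
rewrite gerDr -lerBrDl sub0r; apply: (@le_trans _ _ (`|sl| * r)).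
  apply: le_trans (ler_norm _) _; rewrite normrM gtr0_norm // mulrC.
  by rewrite ler_wpM2l // ltW.
by near: r; apply: near_mul_le.
Unshelve. all: by end_near. Qed.

Section EnvelopeValue.
Variables (R : realType) (n m p q : nat).
Local Notation Z := ('cV[R]_n * 'cV[R]_m)%type.
Variables (f : Z -> R) (G : Z -> 'cV[R]_q) (g : Z -> 'cV[R]_p).
Variables (gamma : R) (zb : Z).
Hypothesis zb_feas : VPfeas f G g gamma zb.

Local Notation phi := (prox_obj f gamma).

Lemma moreau_ge z a :
  (a%:E <= moreau f g gamma z)%E <-> (forall w, feas g z.1 w -> a <= phi z w).
Proof.
split=> [az w wF|az].
  rewrite -lee_fin; apply: le_trans az _; apply: ereal_inf_lbound.
  by exists w.
by apply: le_ereal_inf_tmp => _ [w wF <-]; rewrite lee_fin az.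
Qed.

Lemma VPfeas_min w : feas g zb.1 w -> f zb <= phi zb w.
Proof.
move: w; apply/moreau_ge; have [+ _ _] := zb_feas.
by rewrite sube_le0.
Qed.

Lemma moreau_zb : moreau f g gamma zb = (f zb)%:E.
Proof.
have [_ gzb _] := zb_feas.
apply/eqP; rewrite eq_le; apply/andP; split; last exact/moreau_ge/VPfeas_min.
apply: ge_ereal_inf; exists (phi zb zb.2)%:E.
  by exists zb.2 => //; rewrite /feas /= -surjective_pairing.
by rewrite lee_fin /prox_obj subrr enorm_sqr dot0r mulr0 addr0 -surjective_pairing.
Qed.

End EnvelopeValue.

(** From [zb] move by [t *: (d0 + s *: d)] and correct the result to a feasible point
    [z'] inside the directional neighbourhood.  For suitable [t] the criticality of
    [d0] bounds the envelope from below at [zb + t *: d0].  That point is reached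
    from [z'] along [(- d.1, e - d.2)], so [f] exceeds the envelope at [z'] by at most
    [s * t * slope f zb (0, e)], up to [o(t)].  Were the conclusion false, this excess
    would be too small for calmness at [z'], as [F] changes by at most
    [s * t * slope F zb d], up to [o(t)]. *)
Lemma calm_no_descent (R : realType) (n m p q : nat)
    (F f : 'cV[R]_n * 'cV[R]_m -> R) (G : 'cV[R]_n * 'cV[R]_m -> 'cV[R]_q)
    (g : 'cV[R]_n * 'cV[R]_m -> 'cV[R]_p) (gamma rho_f : R)
    (zb d0 : 'cV[R]_n * 'cV[R]_m) eps delta rho d e :
  cont_diff F -> cont_diff f -> cont_diffv G -> cont_diffv g ->
  0 < gamma -> rho_f < gamma^-1 -> fiber_wconvex f g rho_f -> correctable g zb ->
  VPfeas f G g gamma zb -> critical_cone F f G g gamma zb d0 ->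
  0 < eps -> 0 < delta -> 0 < rho ->
  (forall (alpha : R) (beta : 'cV[R]_q) z,
      enorm (col_mx (alpha%:M : 'cV[R]_1) beta) < eps ->
      gph_feas g z -> dir_nbhd eps delta d0 (z - zb) ->
      ((f z)%:E - moreau f g gamma z + alpha%:E <= 0)%E -> nonpos (G z + beta) ->
      0 <= F z - F zb + rho * enorm (col_mx (alpha%:M : 'cV[R]_1) beta)) ->
  lin_feasible g zb d -> lin_feasible G zb d ->
  lin_feasible g zb (- d.1, e - d.2) ->
  0 <= slope F zb d + rho * slope f zb (0, e).
Proof.
move=> F_C1 f_C1 G_C1 g_C1 gamma_gt0 rho_lt fib corr zb_feas crit.
move=> eps0 delta0 rho0 calm gd Gd gde; rewrite leNgt; apply/negP => descent.
have [_ gzb Gzb] := zb_feas.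
have [dini F0 g0 G0] := crit.
pose sigma := - (slope F zb d + rho * slope f zb (0, e)).
have sigma0 : 0 < sigma by rewrite oppr_gt0.
have [tau tau0 cone] := dir_nbhd_cone d0 delta0.
have nd0 : 0 <= pnorm d by exact: enorm_ge0.
(* a share [s] of [d] this small stays in the directional neighbourhood *)
pose s := tau / 2 / (pnorm d + 1).
have s0 : 0 < s by rewrite !divr_gt0 // ltr_wpDl.
have sd : s * pnorm d <= tau / 2.
  rewrite /s -mulrA ger_pMr ?divr_gt0 // mulrC ler_pdivrMr ?ltr_wpDl //.
  by rewrite mul1r lerDl.
clearbody s; pose h := d0 + s *: d.
have gh : lin_feasible g zb (h.1, h.2).
  move=> i iA; rewrite -surjective_pairing slopeD slopeZ.
  have := g0 i iA; rewrite jac_slope => h1.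
  by rewrite -[leRHS]addr0 lerD // mulr_ge0_le0 ?(ltW s0) // gd.
have Gh : lin_feasible G zb h.
  move=> i iA; rewrite slopeD slopeZ.
  have := G0 i iA; rewrite jac_slope => h1.
  by rewrite -[leRHS]addr0 lerD // mulr_ge0_le0 ?(ltW s0) // Gd.
have [KF KF0 expF] := expansion_along zb h F_C1.
have [Kf Kf0 expf] := expansion_along zb h f_C1.
have [KG KG0 expG] := constraints_along G_C1 Gzb Gh.
pose N : R := (n + m)%:R.
(* [B * eta * t] collects all the error terms of the final estimate *)
pose B := KF + rho * (Kf + 1 + s + q%:R * KG).
have [eta [eta0 eta1 etaN etaB]] : exists eta,
    [/\ 0 < eta, eta <= 1, N * eta <= tau / 2 & B * eta <= s * sigma / 2].
  have /near_witness[eta eta0 [? ? ?]] : \forall eta \near (0 : R)^'+,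
      [/\ eta <= 1, N * eta <= tau / 2 & B * eta <= s * sigma / 2].
    near=> eta; split; near: eta; first exact: nbhs_right_le.
      by apply: near_mul_le; rewrite divr_gt0.
    by apply: near_mul_le; rewrite divr_gt0 // mulr_gt0.
  by exists eta.
have eta01 : 0 < eta <= 1 by rewrite eta0.
have [r1 r10 step] := near_witness (feasible_step g_C1 gzb corr gh eta0).
(* speed, per unit of [s * t], of the second parameter from [z'.2] back to
   [zb.2 + t *: d0.2] *)
pose M := `|d.2| + s^-1.
have [r2 r20 env] := near_witness (envelope_step M f_C1 g_C1 gzb corr gamma_gt0
  rho_lt fib (VPfeas_min zb_feas) gde eta0).
pose H := `|h| + 1; have H0 : 0 < H by rewrite ltr_wpDl.
pose W := s * slope f zb (0, e) + (Kf + 1 + s) * eta.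
have /near_witness[r r0 [rr1 rr3 rr4 rr5 [rF rf rG]]] : \forall r \near (0 : R)^'+,
    [/\ r <= r1, (1 + s + H) * r <= r2, N * H * r < eps,
      (W + q%:R * KG * eta) * r < eps &
    [/\ forall t (b : 'cV[R]_m), 0 < t < r -> `|b| <= eta * t ->
          `|F (zb + (t *: h + (0, b))) - F zb - t * slope F zb h| <= KF * eta * t,
        forall t (b : 'cV[R]_m), 0 < t < r -> `|b| <= eta * t ->
          `|f (zb + (t *: h + (0, b))) - f zb - t * slope f zb h| <= Kf * eta * t &
        forall i t (b : 'cV[R]_m), 0 < t < r -> `|b| <= eta * t ->
          G (zb + (t *: h + (0, b))) i 0 <= KG * eta * t]].
  near=> r; split; last split.
  - by near: r; apply: nbhs_right_le.
  - by near: r; apply: near_mul_le.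
  - by near: r; apply: near_mul_lt.
  - by near: r; apply: near_mul_lt.
  - by near: r; apply: expF.
  - by near: r; apply: expf.
  - by near: r; apply: expG.
have [t t0r mge] := upper_dini_step (moreau_zb zb_feas) dini eta0 r0.
have /andP[t0 tr] := t0r.
rewrite -/(slope f zb d0) in mge.
have [w' w'F w'b] : exists2 w', feas g (zb.1 + t *: h.1) w' &
    `|w' - (zb.2 + t *: h.2)| <= eta * t.
  apply: (step zb.1 zb.2 t) => //.
  - by rewrite -surjective_pairing subrr normr0.
  - by rewrite /feas /= -surjective_pairing.
  - by rewrite t0 /= (lt_le_trans tr).
set b := w' - _ in w'b.
pose z' : 'cV[R]_n * 'cV[R]_m := (zb.1 + t *: h.1, w').
have z'E : z' = zb + (t *: h + (0, b)).
  by congr pair; rewrite /= ?addr0 // /b addrA [RHS]addrC subrK.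
have dzE : z' - zb = t *: h + (0, b) by rewrite z'E addrAC subrr add0r.
have nb : `|(0 : 'cV[R]_n, b)| <= eta * t.
  by apply: normr_pair_le => //; rewrite normr0 mulr_ge0 // ltW.
have eta_t : eta * t <= t by rewrite ger_pMl.
have ndz : `|z' - zb| <= H * t.
  rewrite dzE; apply: le_trans (ler_normD _ _) _; rewrite normrZ gtr0_norm //.
  by move: nb eta_t; rewrite /H; clear; lra.
have HtHr : H * t < H * r by rewrite ltr_pM2l.
have Hr0 : 0 < H * r by rewrite mulr_gt0.
have sr0 : 0 < s * r by rewrite mulr_gt0.
(* [env] is applied at [z'] with step [s * t]: it leads back to the parameter
   [zb.1 + t *: d0.1], where [mge] holds *)
pose L := f zb + t * (slope f zb d0 - eta)
          - s * t * (slope f zb (- d.1, e - d.2) + eta).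
have Lle w0 : feas g z'.1 w0 -> L <= prox_obj f gamma z' w0.
  move=> w0F.
  have st : 0 < s * t < r2.
    rewrite mulr_gt0 //=; have : s * t < s * r by rewrite ltr_pM2l.
    by move: rr3 Hr0 r0; clear; lra.
  have [||||w wF wle] := env z' (s * t) (zb.2 + t *: d0.2) w0 => //.
  - by move: ndz HtHr rr3 r0 sr0; clear; lra.
  - rewrite /= /M mulrDl mulKf ?gt_eqF //.
    have -> : zb.2 + t *: d0.2 - w' = - (t * s *: d.2) - b.
      rewrite /b opprB /h /= scalerDr scalerA [zb.2 + (_ + _)]addrA.
      by rewrite [_ + (t * s *: d.2) - w']addrAC [RHS]addrC addrK.
    apply: le_trans (ler_normB _ _) _; rewrite normrN normrZ gtr0_norm ?mulr_gt0 //.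
    by move: w'b eta_t; clear; lra.
  have {}wF : feas g (zb + t *: d0).1 w.
    move: wF; rewrite /= scalerN scalerDr scalerA [s * t]mulrC addrA addrK.
    by [].
  have := (iffLR (moreau_ge _ _ _ _ _) mge) w wF.
  have -> : prox_obj f gamma (zb + t *: d0) w =
      prox_obj f gamma (zb.1 + t *: h.1 + s * t *: - d.1, zb.2 + t *: d0.2) w.
    congr (prox_obj _ _ (_, _)).
    by rewrite /= scalerN scalerDr scalerA [s * t]mulrC addrA addrK.
  move=> h1; move: (le_trans h1 wle); rewrite /L; clear; lra.
(* the perturbations [alpha] and [beta] make [z'] feasible *)
pose alpha := L - f z'.
pose beta := - pos_part (G z').
have f_z' : f z' = prox_obj f gamma z' z'.2.
  by rewrite /prox_obj subrr enorm_sqr dot0r mulr0 addr0 -surjective_pairing.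
have alpha_le0 : alpha <= 0 by rewrite subr_le0 f_z' Lle.
have fexp := rf t b t0r w'b; rewrite -z'E in fexp.
have Fexp := rF t b t0r w'b; rewrite -z'E in Fexp.
have Gexp i := rG i t b t0r w'b; rewrite -z'E in Gexp.
have slope_de : slope f zb (- d.1, e - d.2) = - slope f zb d + slope f zb (0, e).
  have -> : (- d.1, e - d.2) = - d + (0, e).
    by congr pair; rewrite /= ?addr0 // addrC.
  by rewrite slopeD slopeN.
have alphaW : `|alpha| <= W * t.
  rewrite ler0_norm // /alpha /L slope_de.
  move: fexp; rewrite /h slopeD slopeZ ler_norml => /andP[_].
  rewrite /W; clear; lra.
have betaW : enorm beta <= q%:R * KG * eta * t.
  rewrite /beta -scaleN1r enormZ normrN1 mul1r.
  have := @enorm_pos_part_le R q (G z') (KG * eta * t) _ Gexp.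
  by rewrite !mulrA; apply; rewrite !mulr_ge0 // ltW.
have abW : enorm (col_mx (alpha%:M : 'cV[R]_1) beta) <= (W + q%:R * KG * eta) * t.
  have -> : col_mx (alpha%:M : 'cV[R]_1) beta =
      col_mx (alpha%:M : 'cV[R]_1) 0 + col_mx 0 beta.
    by rewrite add_col_mx addr0 add0r.
  apply: le_trans (enorm_triangle _ _) _.
  have -> : enorm (col_mx (0 : 'cV[R]_1) beta) = enorm beta.
    by rewrite /enorm dot_col_mx dot0r add0r.
  have -> : enorm (col_mx (alpha%:M : 'cV[R]_1) (0 : 'cV[R]_q)) = `|alpha|.
    rewrite /enorm dot_col_mx dot0r addr0 /dot big_ord1 mxE eqxx mulr1n.
    by rewrite -expr2 sqrtr_sqr.
  by rewrite mulrDl lerD.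
have ab0 : 0 <= enorm (col_mx (alpha%:M : 'cV[R]_1) beta) by exact: enorm_ge0.
have WG0 : 0 <= W + q%:R * KG * eta.
  by rewrite -(pmulr_lge0 _ t0) (le_trans ab0).
have pdz : pnorm (z' - zb - t *: d0) <= tau * t.
  have -> : z' - zb - t *: d0 = (t * s) *: d + (0, b).
    by rewrite dzE /h scalerDr scalerA addrAC [t *: d0 + _]addrC addrK.
  apply: le_trans (pnormD _ _) _; rewrite pnormZ gtr0_norm ?mulr_gt0 //.
  have : pnorm (0 : 'cV[R]_n, b) <= N * (eta * t).
    by apply: le_trans (pnorm_le_norm _) _; rewrite ler_wpM2l.
  have : t * (s * pnorm d) <= t * (tau / 2) by rewrite ler_wpM2l // ltW.
  have : t * (N * eta) <= t * (tau / 2) by rewrite ler_wpM2l // ltW.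
  clear; lra.
have Lmoreau : (L%:E <= moreau f g gamma z')%E by apply/moreau_ge.
have : 0 <= F z' - F zb + rho * enorm (col_mx (alpha%:M : 'cV[R]_1) beta).
  apply: calm => //.
  - apply: le_lt_trans abW _; apply: le_lt_trans rr5; rewrite ler_wpM2l //.
    exact: ltW.
  - split; last exact: cone pdz.
    apply: le_lt_trans (pnorm_le_norm _) _; apply: le_lt_trans rr4.
    by rewrite -mulrA ler_wpM2l // ltW // (le_lt_trans ndz).
  - move: Lmoreau; rewrite /alpha; case: (moreau f g gamma z') => [x|_|//].
      by rewrite -EFinB -EFinD !lee_fin; move: (f z') => a; clear; lra.
    by rewrite addeNy addNye leNye.
  - by move=> i; rewrite !mxE subr_le0 le_max lexx.
have : rho * enorm (col_mx (alpha%:M : 'cV[R]_1) beta)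
    <= rho * ((W + q%:R * KG * eta) * t) by rewrite ler_wpM2l // ltW.
move: Fexp; rewrite /h slopeD slopeZ ler_norml => /andP[_].
have F0' : t * slope F zb d0 <= 0 by rewrite mulr_ge0_le0 // ltW.
have : t * (B * eta) <= t * (s * sigma / 2) by rewrite ler_wpM2l // ltW.
have : 0 < t * (s * sigma) by rewrite !mulr_gt0.
move: F0'; rewrite /B /W /sigma; clear; lra.
Unshelve. all: by end_near. Qed.

Theorem corollary5p1 (R : realType) (n m p q : nat)
    (F f : 'cV[R]_n * 'cV[R]_m -> R)
    (G : 'cV[R]_n * 'cV[R]_m -> 'cV[R]_q)
    (g : 'cV[R]_n * 'cV[R]_m -> 'cV[R]_p)
    (gamma : R) (xbar : 'cV[R]_n) (ybar : 'cV[R]_m)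
    (u : 'cV[R]_n) (v : 'cV[R]_m)
    (F_C1 : cont_diff F) (f_C1 : cont_diff f)
    (G_C1 : cont_diffv G) (g_C1 : cont_diffv g)
    (f_wc : forall x, exists rho, wconvex rho setT (fun y => f (x, y)))
    (g_qc : forall x i, quasiconvex (fun y : 'cV[R]_m => g (x, y) i 0))
    (gamma_gt0 : 0 < gamma)
    (minF : VPlocal_min F f G g gamma (xbar, ybar))
    (cond :
      [\/ (forall i, quasiconvex (component g i)) /\
          (exists rho_f : R,
            [/\ 0 < rho_f, pwconvex rho_f (gph_feas g) f
              & gamma < rho_f^-1]) /\
          (\forall x \near xbar, feas g x !=set0) /\
          MSCQ g (xbar, ybar),
          RCR g (xbar, ybar) /\ RS g (xbar, ybar) /\
          (exists rho_f : R,
            (forall x, wconvex rho_f setT (fun y => f (x, y))) /\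
            (0 < rho_f -> gamma < (2 * rho_f)^-1))
        | MFCQ g (xbar, ybar) /\
          (exists rho_f : R,
            (forall x, wconvex rho_f setT (fun y => f (x, y))) /\
            (0 < rho_f -> gamma < (2 * rho_f)^-1))])
    (uv_crit : critical_cone F f G g gamma (xbar, ybar) (u, v))
    (calm : partially_calm F f G g gamma (xbar, ybar) (u, v)) :
  exists (alpha : R) (lam_g : 'cV[R]_p) (lam_G : 'cV[R]_q) (lam : 'cV[R]_p),
    [/\ 0 <= alpha,
        multipliers f g (xbar, ybar) lam,
        0 = grad F (xbar, ybar)
            + (jac g (xbar, ybar))^T *m (lam_g - alpha *: lam)
            + (jac G (xbar, ybar))^T *m lam_G,
        nonneg lam_g /\ dot lam_g (g (xbar, ybar)) = 0
      & nonneg lam_G /\ dot lam_G (G (xbar, ybar)) = 0].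
Proof.
have [zb_feas _] := minF; have [_ gzb _] := zb_feas.
have [rho_f [rho_lt fib corr]] : exists rho_f, [/\ rho_f < gamma^-1,
    fiber_wconvex f g rho_f & correctable g (xbar, ybar)].
  have half rho : (forall x, wconvex rho setT (fun y => f (x, y))) ->
      (0 < rho -> gamma < (2 * rho)^-1) -> rho < gamma^-1.
    move=> wc gammale; have [rho0 _] := wc 0.
    have [rho_gt0|] := ltP 0 rho; last first.
      by move=> rho_le0; apply: le_lt_trans rho_le0 _; rewrite invr_gt0.
    have := gammale rho_gt0; rewrite -[gamma in X in X -> _]invrK.
    rewrite ltf_pV2 ?posrE ?invr_gt0 ?mulr_gt0 //; apply: le_lt_trans.
    by rewrite ler_peMl // ler1n.
  case: cond => [[qc [[rho [rho0 wc gammalt]] [ne mscq]]]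
                |[_ [rs [rho [wc gammale]]]]|[mfcq [rho [wc gammale]]]]; exists rho.
  - split; [|exact: fiber_wconvex_joint|exact: MSCQ_correctable].
    by rewrite -[rho]invrK ltf_pV2 ?posrE ?invr_gt0.
  - split; [exact: half|exact: fiber_wconvex_fibrewise|exact: RS_correctable].
  - split; [exact: half|exact: fiber_wconvex_fibrewise|exact: MFCQ_correctable].
have [eps [delta [rho [eps0 delta0 rho0 calm_ineq]]]] := calm.
have [[lg [lG [mu [lg_c lG_c [mu0 mu_c] statF statf]]]]|
    [d [e [gd Gd gde descent]]]] :=
    kkt_alternative F f G g (xbar, ybar) rho; last first.
  have := calm_no_descent F_C1 f_C1 G_C1 g_C1 gamma_gt0 rho_lt fib corr zb_feas
    uv_crit eps0 delta0 rho0 calm_ineq gd Gd gde.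
  by rewrite leNgt descent.
have rhoN0 : rho != 0 by rewrite gt_eqF.
exists rho, lg, lG, (rho^-1 *: mu); split => //; first exact: ltW.
  split=> [i||].
  - by rewrite mxE mulr_ge0 // invr_ge0 ltW.
  - rewrite -scalemxAr -[grady f _](scalerK rhoN0) -scalerDr.
    by rewrite statf scaler0.
  - by rewrite dotZr mu_c mulr0.
by rewrite scalerA divff // scale1r.
Qed.
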